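(* Let $\mathbf{k}$ be a field of characteristic $0$, and let $\psi\in\mathfrak{f}_2(A,B)$ be homogeneous of degree $n$ and satisfy the two equations $$\psi(A,B)+\psi(B,C)+\psi(C,A)=0\quad\text{where } C=-A-B,$$ $$\psi^{12,3,4}-\psi^{1,23,4}+\psi^{1,2,34}=\psi^{2,3,4}+\psi^{1,2,3}\quad\text{in }\mathfrak{t}_4.$$ If $n$ is odd and $n\geq3$, then the image $[\psi]$ of $\psi$ in $\mathfrak{p}/[\mathfrak{p},\mathfrak{p}]$ is proportional to $[\sigma_n]$, i.e. $i([\psi])$ is a scalar multiple (with scalar in $\mathbf{k}$) of $(\overline A+\overline B)^n-\overline A^n-\overline B^n$. Otherwise, $[\psi]=0$.
   Context: $\mathfrak{f}_2(A,B)$ is the free Lie algebra over $\mathbf{k}$ on generators $A,B$, graded by $\deg A=\deg B=1$. For $n\ge 2$, $\mathfrak{t}_n$ is the Lie algebra over $\mathbf{k}$ with generators $t_{ij}$ ($i\neq j\in\{1,\dots,n\}$) and relations $t_{ij}=t_{ji}$, $[t_{ij}+t_{ik},t_{jk}]=0$ for $i,j,k$ distinct, $[t_{ij},t_{kl}]=0$ for $i,j,k,l$ all distinct. If $I_1,\dots,I_n$ are disjoint subsets of $\{1,\dots,m\}$, the Lie algebra morphism $\mathfrak{t}_n\to\mathfrak{t}_m$, $\psi\mapsto\psi^{I_1,\dots,I_n}$, is defined by $t_{ij}\mapsto\sum_{\alpha\in I_i,\beta\in I_j}t_{\alpha\beta}$ (a subset such as $\{1,2\}$ is written $12$). $\mathfrak{t}_3$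 is the direct sum of its center $\mathbf{k}(t_{12}+t_{13}+t_{23})$ and the free Lie algebra generated by $t_{12},t_{23}$; one identifies $A=t_{12}$, $B=t_{23}$, so that $\mathfrak{f}_2(A,B)\subset\mathfrak{t}_3$. $\mathfrak{p}\subset\mathfrak{f}_2(A,B)$ is the commutator subalgebra $[\mathfrak{f}_2(A,B),\mathfrak{f}_2(A,B)]$, i.e. the sum of the components of degree $>1$. (A homogeneous $\psi$ satisfying the two equations lies in $\mathfrak{p}$: in degree $1$ the only solution is $\psi=0$.) For $k,\ell\ge1$, $p_{k\ell}$ is the class of $\operatorname{ad}(A)^{k-1}\operatorname{ad}(B)^{\ell-1}([A,B])$ in $\mathfrak{p}/[\mathfrak{p},\mathfrak{p}]$; these classes form a basis, and $i:\mathfrak{p}/[\mathfrak{p},\mathfrak{p}]\to(\overline A\,\overline B)\subset\mathbf{k}[\overline A,\overline B]$ is the linear isomorphism $p_{k\ell}\mapsto\overline A^k\overline B^\ell$ onto the ideal generated by $\overline A\,\overline B$ in the commutative polynomial ring. For $n=3,5,7,\dots$, $\sigma_n\in\mathfrak{p}$ denotes Drinfeld's element; its class $[\sigma_n]\in\mathfrak{p}/[\mathfrak{p},\mathfrak{p}]$ satisfies $i([\sigma_n])=(\overline A+\overline B)^n-\overline A^n-\overline B^n$. *)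

(* Defs.v *)
From HB Require Import structures.
From mathcomp Require Import all_boot all_order all_algebra.
From mathcomp Require Import boolp.
From mathcomp Require Import mpoly.
From mathcomp Require Import ring.

Set Implicit Arguments.
Unset Strict Implicit.
Unset Printing Implicit Defensive.

Import GRing.Theory.
Local Open Scope ring_scope.
Local Open Scope quotient_scope.

(** * Lie algebras *)

HB.mixin Record Lmodule_isLie (k : fieldType) L of GRing.Lmodule k L := {
  brk : L -> L -> L;
  brkDl : forall x y z, brk (x + y) z = brk x z + brk y z;
  brkDr : forall x y z, brk x (y + z) = brk x y + brk x z;
  brkZl : forall a x y, brk (a *: x) y = a *: brk x y;
  brkZr : forall a x y, brk x (a *: y) = a *: brk x y;
  brkxx : forall x, brk x x = 0;
  jacobi : forall x y z, brk x (brk y z) + brk y (brk z x) + brk z (brk x y) = 0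
}.

#[short(type="lieType")]
HB.structure Definition Lie (k : fieldType) :=
  { L of Lmodule_isLie k L & GRing.Lmodule k L }.

Notation "[lie x , y ]" := (brk x y)
  (at level 0, x, y at level 200, format "[lie  x ,  y ]") : ring_scope.

Section LieTheory.
Variables (k : fieldType) (L : lieType k).
Implicit Types x y z : L.

Lemma brk_anti x y : [lie x, y] = - [lie y, x].
Proof.
have := brkxx (x + y); rewrite brkDl !brkDr !brkxx add0r addr0.
by move/eqP; rewrite addr_eq0 => /eqP.
Qed.

Lemma brk0l x : [lie 0, x] = 0.
Proof. by rewrite -[X in [lie X, _]](scale0r 0) brkZl scale0r. Qed.

Lemma brk0r x : [lie x, 0] = 0.
Proof. by rewrite brk_anti brk0l oppr0. Qed.

Lemma brkNl x y : [lie - x, y] = - [lie x, y].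
Proof. by rewrite -scaleN1r brkZl scaleN1r. Qed.

Lemma brkNr x y : [lie x, - y] = - [lie x, y].
Proof. by rewrite -scaleN1r brkZr scaleN1r. Qed.

Lemma brk_suml (I : Type) (r : seq I) (P : pred I) (F : I -> L) y :
  [lie \sum_(i <- r | P i) F i, y] = \sum_(i <- r | P i) [lie F i, y].
Proof.
by elim/big_rec2: _ => [|i u v _ <-]; rewrite ?brk0l ?brkDl.
Qed.

Lemma brk_sumr (I : Type) (r : seq I) (P : pred I) (F : I -> L) y :
  [lie y, \sum_(i <- r | P i) F i] = \sum_(i <- r | P i) [lie y, F i].
Proof.
by elim/big_rec2: _ => [|i u v _ <-]; rewrite ?brk0r ?brkDr.
Qed.

(* The Leibniz rule for the derivation [ad x] *)
Lemma brk_leibniz x y z :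
  [lie x, [lie y, z]] = [lie [lie x, y], z] + [lie y, [lie x, z]].
Proof.
have := jacobi x y z; rewrite (brk_anti z x) brkNr (brk_anti z [lie x, y]).
move/eqP; rewrite subr_eq0 => /eqP <-.
by rewrite addrNK.
Qed.

Definition lie_morphism (M N : lieType k) (g : M -> N) : Prop :=
  linear g /\ forall x y : M, g [lie x, y] = [lie g x, g y].

End LieTheory.

(** * Linear span and quotient of a module by a submodule *)

Section Span.
Variables (k : fieldType) (V : lmodType k).

Inductive in_span (S : V -> Prop) : V -> Prop :=
| span_in x : S x -> in_span S x
| span_0 : in_span S 0
| span_lin (a : k) x y : in_span S x -> in_span S y -> in_span S (a *: x + y).

Definition span (S : V -> Prop) : {pred V} := [pred x | `[< in_span S x >]].

Lemma spanP S x : reflect (in_span S x) (x \in span S).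
Proof. exact: asboolP. Qed.

Lemma span_submod S : subsemimod_closed (span S).
Proof.
split; first split.
- exact/spanP/span_0.
- move=> x y /spanP hx /spanP hy; apply/spanP.
  by rewrite -(scale1r x); apply: span_lin.
- move=> a x /spanP hx; apply/spanP.
  by rewrite -(addr0 (a *: x)); apply: span_lin => //; exact: span_0.
Qed.

HB.instance Definition _ S := GRing.isSubmodClosed.Build k V (span S)
  (span_submod S).

End Span.

Section QuotLmod.
Variables (k : fieldType) (V : lmodType k) (S : V -> Prop).

Definition lquot := Quotient.quot (span S : zmodClosed V).
HB.instance Definition _ := GRing.Zmodule.on lquot.
HB.instance Definition _ := EqQuotient.on lquot.
HB.instance Definition _ := ZmodQuotient.on lquot.

Definition lquot_scale (a : k) (x : lquot) : lquot := \pi_lquot (a *: repr x).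

Lemma pi_lquot_scale a x :
  lquot_scale a (\pi_lquot x) = \pi_lquot (a *: x).
Proof.
apply/eqP; rewrite /lquot_scale -Quotient.idealrBE -scalerBr.
by apply: rpredZ; rewrite Quotient.idealrBE reprK.
Qed.

Let lquotP (v : lquot) : exists x, v = \pi_lquot x.
Proof. by exists (repr v); rewrite reprK. Qed.

Fact lquot_scaleA a b v :
  lquot_scale a (lquot_scale b v) = lquot_scale (a * b) v.
Proof. by have [x ->] := lquotP v; rewrite !pi_lquot_scale scalerA. Qed.

Fact lquot_scale1 : left_id 1 lquot_scale.
Proof. by move=> v; have [x ->] := lquotP v; rewrite pi_lquot_scale scale1r. Qed.

Fact lquot_scaleDr : right_distributive lquot_scale +%R.
Proof.
move=> a u v; have [x ->] := lquotP u; have [y ->] := lquotP v.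
by rewrite -raddfD !pi_lquot_scale -raddfD scalerDr.
Qed.

Fact lquot_scaleDl v : {morph lquot_scale^~ v : a b / a + b}.
Proof.
move=> a b; have [x ->] := lquotP v.
by rewrite !pi_lquot_scale -raddfD scalerDl.
Qed.

HB.instance Definition _ := GRing.Zmodule_isLmodule.Build k lquot
  lquot_scaleA lquot_scale1 lquot_scaleDr lquot_scaleDl.

Definition lcls (x : V) : lquot := \pi_lquot x.

Lemma lcls_is_linear : linear lcls.
Proof.
move=> a x y; rewrite /lcls raddfD; congr (_ + _).
exact/esym/pi_lquot_scale.
Qed.

HB.instance Definition _ := GRing.isLinear.Build k V lquot _ lcls lcls_is_linear.

Lemma lcls_eq0 x : (lcls x == 0) = (x \in span S).
Proof. by rewrite -(raddf0 lcls) /lcls -Quotient.idealrBE subr0. Qed.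

Lemma lcls_surj (y : lquot) : exists x, y = lcls x.
Proof. by exists (repr y); rewrite /lcls reprK. Qed.

End QuotLmod.

(** * Commutator subalgebra and abelianization of a Lie algebra *)

Section Derived.
Variables (k : fieldType) (L : lieType k).

Definition is_brk (z : L) : Prop := exists x y : L, z = [lie x, y].

Record derived := Derived {
  derived_val : L;
  derived_valP : derived_val \in span is_brk
}.

HB.instance Definition _ := [isSub for derived_val].
HB.instance Definition _ := [Choice of derived by <:].
HB.instance Definition _ := [SubChoice_isSubLmodule of derived by <:].

Lemma brk_derived (x y : L) : [lie x, y] \in span is_brk.
Proof. by apply/spanP/span_in; exists x, y. Qed.

Definition derived_brk (x y : derived) : derived :=
  Derived (brk_derived (val x) (val y)).

Fact derived_brkDl x y z :
  derived_brk (x + y) z = derived_brk x z + derived_brk y z.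
Proof. by apply: val_inj; rewrite /= brkDl. Qed.
Fact derived_brkDr x y z :
  derived_brk x (y + z) = derived_brk x y + derived_brk x z.
Proof. by apply: val_inj; rewrite /= brkDr. Qed.
Fact derived_brkZl a x y : derived_brk (a *: x) y = a *: derived_brk x y.
Proof. by apply: val_inj; rewrite /= brkZl. Qed.
Fact derived_brkZr a x y : derived_brk x (a *: y) = a *: derived_brk x y.
Proof. by apply: val_inj; rewrite /= brkZr. Qed.
Fact derived_brkxx x : derived_brk x x = 0.
Proof. by apply: val_inj; rewrite /= brkxx. Qed.
Fact derived_jacobi x y z :
  derived_brk x (derived_brk y z) + derived_brk y (derived_brk z x)
    + derived_brk z (derived_brk x y) = 0.
Proof. by apply: val_inj; rewrite /= jacobi. Qed.

HB.instance Definition _ := Lmodule_isLie.Build k derived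
  derived_brkDl derived_brkDr derived_brkZl derived_brkZr derived_brkxx
  derived_jacobi.

(* [L / [L, L]] *)
Definition abel := lquot is_brk.
HB.instance Definition _ := GRing.Lmodule.on abel.

Definition abel_cls : L -> abel := @lcls k L is_brk.
HB.instance Definition _ := GRing.Linear.on abel_cls.

Lemma abel_cls_brk (x y : L) : abel_cls [lie x, y] = 0.
Proof. by apply/eqP; rewrite lcls_eq0; exact: brk_derived. Qed.

End Derived.

(** * Lie algebras given by generators and relations *)

Section Presentation.
Variables (k : fieldType) (X : Type).

Inductive lterm : Type :=
| LGen of X
| LZero
| LAdd of lterm & lterm
| LScale of k & lterm
| LBrk of lterm & lterm.

HB.instance Definition _ := gen_eqMixin lterm.
HB.instance Definition _ := gen_choiceMixin lterm.

Variable rels : lterm -> Prop.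

(* The smallest congruence making terms into a Lie algebra and killing [rels] *)
Inductive lequiv : lterm -> lterm -> Prop :=
| le_refl t : lequiv t t
| le_sym t u : lequiv t u -> lequiv u t
| le_trans t u v : lequiv t u -> lequiv u v -> lequiv t v
| le_add t t' u u' : lequiv t t' -> lequiv u u' -> lequiv (LAdd t u) (LAdd t' u')
| le_scale a t t' : lequiv t t' -> lequiv (LScale a t) (LScale a t')
| le_brk t t' u u' : lequiv t t' -> lequiv u u' -> lequiv (LBrk t u) (LBrk t' u')
| le_addA t u v : lequiv (LAdd t (LAdd u v)) (LAdd (LAdd t u) v)
| le_addC t u : lequiv (LAdd t u) (LAdd u t)
| le_add0 t : lequiv (LAdd LZero t) t
| le_addN t : lequiv (LAdd (LScale (- 1) t) t) LZero
| le_scaleA a b t : lequiv (LScale a (LScale b t)) (LScale (a * b) t)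
| le_scale1 t : lequiv (LScale 1 t) t
| le_scaleDr a t u : lequiv (LScale a (LAdd t u)) (LAdd (LScale a t) (LScale a u))
| le_scaleDl a b t : lequiv (LScale (a + b) t) (LAdd (LScale a t) (LScale b t))
| le_brkDl t u v : lequiv (LBrk (LAdd t u) v) (LAdd (LBrk t v) (LBrk u v))
| le_brkDr t u v : lequiv (LBrk t (LAdd u v)) (LAdd (LBrk t u) (LBrk t v))
| le_brkZl a t u : lequiv (LBrk (LScale a t) u) (LScale a (LBrk t u))
| le_brkZr a t u : lequiv (LBrk t (LScale a u)) (LScale a (LBrk t u))
| le_brkxx t : lequiv (LBrk t t) LZero
| le_jacobi t u v :
    lequiv (LAdd (LAdd (LBrk t (LBrk u v)) (LBrk u (LBrk v t)))
              (LBrk v (LBrk t u))) LZero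
| le_rel t : rels t -> lequiv t LZero.

Definition lequivb (t u : lterm) : bool := `[< lequiv t u >].

Fact lequivb_equiv : equiv_class_of lequivb.
Proof.
split=> [t|t u|u t v].
- exact/asboolP/le_refl.
- by apply/asboolP/asboolP; exact: le_sym.
- by move=> /asboolP h1 /asboolP h2; apply/asboolP/(le_trans h1 h2).
Qed.

Canonical lequivb_equivRel := EquivRelPack lequivb_equiv.
Canonical lequivb_encModRel := defaultEncModRel lequivb.

(* The Lie algebra with generators [X] and relations [t = 0] for [rels t] *)
Definition pres := {eq_quot lequivb}.
HB.instance Definition _ := EqQuotient.on pres.
HB.instance Definition _ := Choice.on pres.

Implicit Types x y z : pres.

Lemma pres_eq (t u : lterm) :
  \pi_pres t = \pi_pres u <-> lequiv t u.
Proof.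
split=> [/eqP|h]; first by rewrite piE => /asboolP.
by apply/eqP; rewrite piE; exact/asboolP.
Qed.

Lemma pres_repr (t : lterm) : lequiv (repr (\pi_pres t)) t.
Proof. by apply/pres_eq; rewrite reprK. Qed.

Definition pres_add x y : pres := \pi_pres (LAdd (repr x) (repr y)).
Definition pres_scale a x : pres := \pi_pres (LScale a (repr x)).
Definition pres_brk x y : pres := \pi_pres (LBrk (repr x) (repr y)).
Definition pres_zero : pres := \pi_pres LZero.

Lemma pi_add t u : pres_add (\pi_pres t) (\pi_pres u) = \pi_pres (LAdd t u).
Proof. by apply/pres_eq/le_add; exact: pres_repr. Qed.
Lemma pi_scale a t : pres_scale a (\pi_pres t) = \pi_pres (LScale a t).
Proof. by apply/pres_eq/le_scale; exact: pres_repr. Qed.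
Lemma pi_brk t u : pres_brk (\pi_pres t) (\pi_pres u) = \pi_pres (LBrk t u).
Proof. by apply/pres_eq/le_brk; exact: pres_repr. Qed.

Let piP x : exists t, x = \pi_pres t.
Proof. by exists (repr x); rewrite reprK. Qed.

Fact pres_addA : associative pres_add.
Proof.
move=> x y z; have [t ->] := piP x; have [u ->] := piP y; have [v ->] := piP z.
by rewrite !pi_add; apply/pres_eq/le_addA.
Qed.
Fact pres_addC : commutative pres_add.
Proof.
move=> x y; have [t ->] := piP x; have [u ->] := piP y.
by rewrite !pi_add; apply/pres_eq/le_addC.
Qed.
Fact pres_add0 : left_id pres_zero pres_add.
Proof.
by move=> x; have [t ->] := piP x; rewrite pi_add; apply/pres_eq/le_add0.
Qed.
Fact pres_addN : left_inverse pres_zero (pres_scale (- 1)) pres_add.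
Proof.
move=> x; have [t ->] := piP x.
by rewrite pi_scale pi_add; apply/pres_eq/le_addN.
Qed.

HB.instance Definition _ := GRing.isZmodule.Build pres
  pres_addA pres_addC pres_add0 pres_addN.

Lemma piD t u : \pi_pres (LAdd t u) = \pi_pres t + \pi_pres u.
Proof. exact/esym/pi_add. Qed.

Fact pres_scaleA a b x : pres_scale a (pres_scale b x) = pres_scale (a * b) x.
Proof.
have [t ->] := piP x; rewrite !pi_scale; exact/pres_eq/le_scaleA.
Qed.
Fact pres_scale1 : left_id 1 pres_scale.
Proof.
by move=> x; have [t ->] := piP x; rewrite !pi_scale; apply/pres_eq/le_scale1.
Qed.
Fact pres_scaleDr : right_distributive pres_scale +%R.
Proof.
move=> a x y; have [t ->] := piP x; have [u ->] := piP y.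
by rewrite -piD !pi_scale -piD; apply/pres_eq/le_scaleDr.
Qed.
Fact pres_scaleDl x : {morph pres_scale^~ x : a b / a + b}.
Proof.
move=> a b; have [t ->] := piP x.
by rewrite !pi_scale -piD; apply/pres_eq/le_scaleDl.
Qed.

HB.instance Definition _ := GRing.Zmodule_isLmodule.Build k pres
  pres_scaleA pres_scale1 pres_scaleDr pres_scaleDl.

Lemma piZ a t : \pi_pres (LScale a t) = a *: \pi_pres t.
Proof. exact/esym/pi_scale. Qed.

Fact pres_brkDl x y z : pres_brk (x + y) z = pres_brk x z + pres_brk y z.
Proof.
have [t ->] := piP x; have [u ->] := piP y; have [v ->] := piP z.
by rewrite -piD !pi_brk -piD; apply/pres_eq/le_brkDl.
Qed.
Fact pres_brkDr x y z : pres_brk x (y + z) = pres_brk x y + pres_brk x z.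
Proof.
have [t ->] := piP x; have [u ->] := piP y; have [v ->] := piP z.
by rewrite -piD !pi_brk -piD; apply/pres_eq/le_brkDr.
Qed.
Fact pres_brkZl a x y : pres_brk (a *: x) y = a *: pres_brk x y.
Proof.
have [t ->] := piP x; have [u ->] := piP y.
by rewrite -piZ !pi_brk -piZ; apply/pres_eq/le_brkZl.
Qed.
Fact pres_brkZr a x y : pres_brk x (a *: y) = a *: pres_brk x y.
Proof.
have [t ->] := piP x; have [u ->] := piP y.
by rewrite -piZ !pi_brk -piZ; apply/pres_eq/le_brkZr.
Qed.
Fact pres_brkxx x : pres_brk x x = 0.
Proof. by have [t ->] := piP x; rewrite pi_brk; apply/pres_eq/le_brkxx. Qed.
Fact pres_jacobi x y z :
  pres_brk x (pres_brk y z) + pres_brk y (pres_brk z x)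
    + pres_brk z (pres_brk x y) = 0.
Proof.
have [t ->] := piP x; have [u ->] := piP y; have [v ->] := piP z.
by rewrite !pi_brk -!piD; apply/pres_eq/le_jacobi.
Qed.

HB.instance Definition _ := Lmodule_isLie.Build k pres
  pres_brkDl pres_brkDr pres_brkZl pres_brkZr pres_brkxx pres_jacobi.

Lemma piB t u : \pi_pres (LBrk t u) = [lie \pi_pres t, \pi_pres u].
Proof. exact/esym/pi_brk. Qed.

Definition pgen (g : X) : pres := \pi_pres (LGen g).

Lemma pres_ind (P : pres -> Prop) :
  (forall g, P (pgen g)) -> P 0 -> (forall x y, P x -> P y -> P (x + y)) ->
  (forall a x, P x -> P (a *: x)) ->
  (forall x y, P x -> P y -> P [lie x, y]) -> forall x, P x.
Proof.
move=> Pg P0 PD PZ PB x; have [t ->] := piP x; elim: t => //.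
- by move=> t ht u hu; rewrite piD; exact: PD.
- by move=> a t ht; rewrite piZ; exact: PZ.
- by move=> t ht u hu; rewrite piB; exact: PB.
Qed.

(* Universal property: [plift f] is the Lie algebra morphism sending [pgen x]
   to [f x] as soon as [f] satisfies the relations, see [plift_morph]. *)
Variable L : lieType k.

Fixpoint leval (f : X -> L) (t : lterm) : L :=
  match t with
  | LGen x => f x
  | LZero => 0
  | LAdd t u => leval f t + leval f u
  | LScale a t => a *: leval f t
  | LBrk t u => [lie leval f t, leval f u]
  end.

Definition plift (f : X -> L) (x : pres) : L := leval f (repr x).

Lemma leval_equiv f : (forall t, rels t -> leval f t = 0) ->
  forall t u, lequiv t u -> leval f t = leval f u.
Proof.
move=> hf t u; elim=> {t u} //=.
- by move=> t u v _ -> _ ->.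
- by move=> t t' u u' _ -> _ ->.
- by move=> a t t' _ ->.
- by move=> t t' u u' _ -> _ ->.
- by move=> *; rewrite addrA.
- by move=> *; rewrite addrC.
- by move=> *; rewrite add0r.
- by move=> *; rewrite scaleN1r addNr.
- by move=> *; rewrite scalerA.
- by move=> *; rewrite scale1r.
- by move=> *; rewrite scalerDr.
- by move=> *; rewrite scalerDl.
- by move=> *; rewrite brkDl.
- by move=> *; rewrite brkDr.
- by move=> *; rewrite brkZl.
- by move=> *; rewrite brkZr.
- by move=> *; rewrite brkxx.
- by move=> *; rewrite jacobi.
Qed.

Lemma plift_morph f : (forall t, rels t -> leval f t = 0) ->
  lie_morphism (plift f) /\ forall g, plift f (pgen g) = f g.
Proof.
move=> hf; have piE t : plift f (\pi_pres t) = leval f t.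
  by apply: (leval_equiv hf); exact: pres_repr.
split; last by move=> x; rewrite piE.
split=> [a x y|x y]; have [t ->] := piP x; have [u ->] := piP y.
- by rewrite -piZ -piD !piE.
- by rewrite -piB !piE.
Qed.

End Presentation.

(** * The free Lie algebra on two generators *)

Variant gen2 := GenA | GenB.

Definition f2 (k : fieldType) := pres (fun _ : lterm k gen2 => False).
HB.instance Definition _ (k : fieldType) := Lie.on (f2 k).

Section Free2.
Variable k : fieldType.

Definition genA : f2 k := pgen _ GenA.
Definition genB : f2 k := pgen _ GenB.

(* [psi(x, y)]: the image of [psi] under the Lie algebra morphism from [f2 k]
   sending A to [x] and B to [y] *)
Definition lsubst (L : lieType k) (psi : f2 k) (x y : L) : L :=
  plift (fun g => match g with GenA => x | GenB => y end) psi.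

Lemma lsubst_morph (L : lieType k) (x y : L) :
  [/\ lie_morphism (fun psi => lsubst psi x y),
      lsubst genA x y = x & lsubst genB x y = y].
Proof.
have [//|h e] := @plift_morph k gen2 (fun=> False) L
  (fun g => match g with GenA => x | GenB => y end).
by split=> //; [have := e GenA | have := e GenB].
Qed.

Inductive lie_monomial : nat -> f2 k -> Prop :=
| lmon_A : lie_monomial 1%N genA
| lmon_B : lie_monomial 1%N genB
| lmon_brk m n x y : lie_monomial m x -> lie_monomial n y ->
    lie_monomial (m + n)%N [lie x, y].

(* The component of degree [n] is spanned by the iterated brackets of [n] letters *)
Definition homogeneous (n : nat) (psi : f2 k) : Prop := psi \in span (lie_monomial n).

End Free2.

(** * The Lie algebras t_n *)

Definition tgen (n : nat) := {ij : 'I_n * 'I_n | ij.1 != ij.2}.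

Section Drinfeld_Kohno.
Variables (k : fieldType).

Section Relations.
Variable n : nat.

Definition tgen_term (i j : 'I_n) (h : i != j) : lterm k (tgen n) :=
  LGen k (exist (fun ij : 'I_n * 'I_n => ij.1 != ij.2) (i, j) h).

Inductive trel : lterm k (tgen n) -> Prop :=
| trel_sym i j (ij : i != j) (ji : j != i) :
    trel (LAdd (tgen_term ij) (LScale (- 1) (tgen_term ji)))
| trel_3 i j l (ij : i != j) (il : i != l) (jl : j != l) :
    trel (LBrk (LAdd (tgen_term ij) (tgen_term il)) (tgen_term jl))
| trel_4 i j l m (ij : i != j) (lm : l != m) :
    uniq [:: i; j; l; m] -> trel (LBrk (tgen_term ij) (tgen_term lm)).

Definition tn := pres trel.
HB.instance Definition _ := Lie.on tn.

(* The generator t_ij, extended by the junk value t_ii = 0 *)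
Definition t (i j : 'I_n) : tn :=
  if insub (i, j) is Some g then pgen trel g else 0.

End Relations.

Definition ins_gen (n m : nat) (I : n.-tuple {set 'I_m}) (g : tgen n) : tn m :=
  \sum_(a in tnth I (val g).1) \sum_(b in tnth I (val g).2) t a b.

(* psi |-> psi^{I_1, ..., I_n}, with [I_i] = [tnth I i]; a Lie algebra
   morphism when the subsets are pairwise disjoint, see [ins_morph] *)
Definition ins (n m : nat) (I : n.-tuple {set 'I_m}) : tn n -> tn m :=
  plift (ins_gen I).

Lemma tE n (i j : 'I_n) (h : i != j) : t i j = pgen (@trel n) (exist _ (i, j) h).
Proof.
rewrite /t; case: insubP => [u _ hu|]; last by rewrite h.
by congr pgen; apply: val_inj.
Qed.

Lemma tC n (i j : 'I_n) : t i j = t j i.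
Proof.
have [->//|ij] := eqVneq i j; have ji : j != i by rewrite eq_sym.
rewrite (tE ij) (tE ji); apply/eqP; rewrite -subr_eq0; apply/eqP.
rewrite -scaleN1r /pgen -piZ -piD.
by apply/pres_eq/le_rel; exact: (trel_sym ij ji).
Qed.

Lemma t_rel3 n (i j l : 'I_n) : i != j -> i != l -> j != l ->
  [lie t i j + t i l, t j l] = 0.
Proof.
move=> ij il jl; rewrite (tE ij) (tE il) (tE jl) /pgen -piD -piB.
by apply/pres_eq/le_rel; exact: trel_3.
Qed.

Lemma t_rel4 n (i j l m : 'I_n) : uniq [:: i; j; l; m] ->
  [lie t i j, t l m] = 0.
Proof.
move=> u; have ij : i != j by move: u; rewrite /= !inE; case: eqP.
have lm : l != m by move: u; rewrite /= !inE; case: (l =P m) => //= _; rewrite !andbF.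
rewrite (tE ij) (tE lm) /pgen -piB.
by apply/pres_eq/le_rel; exact: trel_4.
Qed.

Definition disjoint_family (n m : nat) (I : n.-tuple {set 'I_m}) : Prop :=
  forall i j, i != j -> [disjoint tnth I i & tnth I j].

Let tsum m (U W : {set 'I_m}) : tn m := \sum_(a in U) \sum_(b in W) t a b.

Lemma disj_neq m (U W : {set 'I_m}) a b :
  [disjoint U & W] -> a \in U -> b \in W -> a != b.
Proof.
by move=> /disjointFr h aU bW; apply/eqP => e; move: (h a aU); rewrite e bW.
Qed.

Lemma tsum_rel3 m (U V W : {set 'I_m}) :
  [disjoint U & V] -> [disjoint U & W] -> [disjoint V & W] ->
  [lie tsum U V + tsum U W, tsum V W] = 0.
Proof.
move=> UV UW VW; rewrite /tsum -big_split /= brk_suml big1 // => a aU.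
rewrite brk_sumr big1 // => b bV; rewrite brk_sumr big1 // => c cW.
have ab := disj_neq UV aU bV; have ac := disj_neq UW aU cW.
have bc := disj_neq VW bV cW.
rewrite brkDl !brk_suml (bigD1 b) //= (bigD1 c cW) /=.
rewrite big1 ?addr0 ?[X in _ + (_ + X)]big1 ?addr0 -?brkDl; first exact: t_rel3.
- move=> c' /andP[c'W c'c]; have bc' := disj_neq VW bV c'W.
  have ac' := disj_neq UW aU c'W.
  by apply: t_rel4; rewrite /= !inE !negb_or ac' ab ac bc c'c [c' == b]eq_sym bc'.
- move=> b' /andP[b'V b'b]; have b'c := disj_neq VW b'V cW.
  have ab' := disj_neq UV aU b'V.
  by apply: t_rel4; rewrite /= !inE !negb_or ab' ab ac bc b'b b'c.
Qed.

Lemma ins_morph (n m : nat) (I : n.-tuple {set 'I_m}) : disjoint_family I ->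
  lie_morphism (ins I) /\ forall i j, i != j ->
    ins I (t i j) = \sum_(a in tnth I i) \sum_(b in tnth I j) t a b.
Proof.
move=> dI; have [|h e] := @plift_morph k (tgen n) (@trel n) _ (ins_gen I).
  move=> _ [i j ij ji|i j l ij il jl|i j l p ij lp u] /=; rewrite /ins_gen /=.
  - rewrite scaleN1r [X in _ - X]exchange_big /=.
    apply/eqP; rewrite subr_eq0; apply/eqP.
    by apply: eq_bigr => a _; apply: eq_bigr => b _; rewrite tC.
  - by apply: tsum_rel3; exact: dI.
  - rewrite brk_suml big1 // => a aU; rewrite brk_suml big1 // => b bV.
    rewrite brk_sumr big1 // => c cW; rewrite brk_sumr big1 // => d dS.
    apply: t_rel4; move: u; rewrite /= !inE !negb_or !andbT.
    case/andP=> /and3P[h1 h2 h3] /andP[/andP[h4 h5] h6].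
    by rewrite (disj_neq (dI _ _ h1) aU bV)
      (disj_neq (dI _ _ h2) aU cW) (disj_neq (dI _ _ h3) aU dS)
      (disj_neq (dI _ _ h4) bV cW) (disj_neq (dI _ _ h5) bV dS)
      (disj_neq (dI _ _ h6) cW dS).
by split=> // i j ij; rewrite (tE ij) /ins e.
Qed.

(* The index [j] of {1, ..., n+1}, as an element of ['I_n.+1] (0-based) *)
Definition strand (n j : nat) : 'I_n.+1 := inord j.-1.

(* The inclusion of [f2 k] in t_3: A = t_12, B = t_23 *)
Definition f2_t3 (psi : f2 k) : tn 3 :=
  lsubst psi (t (strand 2 1) (strand 2 2)) (t (strand 2 2) (strand 2 3)).

(* psi^{I_1, I_2, I_3}, through the inclusion of [f2 k] in t_3 *)
Definition ins3 (I1 I2 I3 : {set 'I_4}) (psi : f2 k) : tn 4 :=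
  ins [tuple I1; I2; I3] (f2_t3 psi).

End Drinfeld_Kohno.

(** * The abelianization of p = [f2, f2] *)

(* p = [f2, f2]; this is a Lie algebra, and p/[p, p] is its abelianization *)
Definition pp (k : fieldType) := derived (f2 k).
HB.instance Definition _ (k : fieldType) := Lie.on (pp k).
HB.instance Definition _ (k : fieldType) := SubType.on (pp k).

Definition pab (k : fieldType) := abel (pp k).
HB.instance Definition _ (k : fieldType) := GRing.Lmodule.on (pab k).

Section Pab.
Variable k : fieldType.

Definition pcls : pp k -> pab k := @abel_cls k (pp k).
HB.instance Definition _ := GRing.Linear.on pcls.

(* ad(A)^a ad(B)^b [A, B] *)
Definition adAB (a b : nat) : f2 k :=
  iter a (brk (genA k)) (iter b (brk (genB k)) [lie genA k, genB k]).

Lemma adAB_p a b : adAB a b \in span (@is_brk k (f2 k)).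
Proof. by case: a => [|a]; first case: b => [|b]; exact: brk_derived. Qed.

(* For [a, b >= 1], the class of ad(A)^(a-1) ad(B)^(b-1) [A, B] *)
Definition pbasis (a b : nat) : pab k := pcls (Derived (adAB_p a.-1 b.-1)).

End Pab.

(* The metabelian Lie algebra [k A + k B + k[A, B]], in which [A, B] is the
   polynomial AB, polynomials commute with each other and A and B act on them
   by multiplication; it serves to show that the map [p_iso] below exists *)
Section Metabelian.
Variable k : fieldType.

Definition metab : Type := (k^o * k^o * {mpoly k[2]})%type.
HB.instance Definition _ := GRing.Lmodule.on metab.

Local Notation X0 := ('X_ord0 : {mpoly k[2]}).
Local Notation X1 := ('X_ord_max : {mpoly k[2]}).

Definition metab_brk (u v : metab) : metab :=
  let a := @mpolyC 2 k u.1.1 in let b := @mpolyC 2 k u.1.2 in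
  let c := @mpolyC 2 k v.1.1 in let d := @mpolyC 2 k v.1.2 in
  ((0, 0), (a * d - b * c) * (X0 * X1)
             + (a * X0 + b * X1) * v.2 - (c * X0 + d * X1) * u.2).

Let metabP (u v : metab) : u.1.1 = v.1.1 -> u.1.2 = v.1.2 -> u.2 = v.2 -> u = v.
Proof. by case: u v => [[a b] f] [[c d] g] /= -> -> ->. Qed.

Local Ltac mring :=
  rewrite ?mpolyC0 ?mpolyC1 ?mpolyCD ?mpolyCM;
  repeat match goal with |- context [@mpolyC ?n ?R ?x] =>
    let y := fresh "y" in set y : {mpoly k[2]} := @mpolyC n R x; clearbody y end;
  repeat match goal with |- context [@snd ?U ?V ?x] =>
    let y := fresh "y" in set y : {mpoly k[2]} := @snd U V x; clearbody y end;
  ring.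

Fact metab_brkxx u : metab_brk u u = 0.
Proof. by apply: metabP => //=; mring. Qed.

Fact metab_brk_anti u v : metab_brk u v = - metab_brk v u.
Proof. by apply: metabP => /=; rewrite ?oppr0 //; mring. Qed.

Fact metab_brkDl u v w : metab_brk (u + v) w = metab_brk u w + metab_brk v w.
Proof. by apply: metabP => /=; rewrite ?addr0 //; mring. Qed.

Fact metab_brkZl a u v : metab_brk (a *: u) v = a *: metab_brk u v.
Proof.
by apply: metabP => /=; rewrite ?scaler0 // -!mul_mpolyC; mring.
Qed.

Fact metab_brkDr u v w : metab_brk u (v + w) = metab_brk u v + metab_brk u w.
Proof. by apply: metabP => /=; rewrite ?addr0 //; mring. Qed.

Fact metab_brkZr a u v : metab_brk u (a *: v) = a *: metab_brk u v.
Proof.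
by apply: metabP => /=; rewrite ?scaler0 // -!mul_mpolyC; mring.
Qed.

Fact metab_jacobi u v w :
  metab_brk u (metab_brk v w) + metab_brk v (metab_brk w u)
    + metab_brk w (metab_brk u v) = 0.
Proof. by apply: metabP => /=; rewrite ?addr0 //; mring. Qed.

HB.instance Definition _ := Lmodule_isLie.Build k metab
  metab_brkDl metab_brkDr metab_brkZl metab_brkZr metab_brkxx metab_jacobi.

Let mA : metab := ((1, 0), 0).
Let mB : metab := ((0, 1), 0).

Definition to_metab (x : f2 k) : metab := lsubst x mA mB.

Fact to_metab_morph : lie_morphism to_metab.
Proof. by have [] := lsubst_morph mA mB. Qed.
HB.instance Definition _ := GRing.isLinear.Build k (f2 k) metab _ to_metab
  to_metab_morph.1.

Lemma to_metab_brk x y : to_metab [lie x, y] = [lie to_metab x, to_metab y].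
Proof. exact: to_metab_morph.2. Qed.

Lemma to_metabA : to_metab (genA k) = mA.
Proof. by have [] := lsubst_morph mA mB. Qed.
Lemma to_metabB : to_metab (genB k) = mB.
Proof. by have [] := lsubst_morph mA mB. Qed.

Lemma to_metab_adAB a b : to_metab (adAB k a b) = ((0, 0), X0 ^+ a.+1 * X1 ^+ b.+1).
Proof.
rewrite /adAB; elim: a => [|a IH] /=.
  elim: b => [|b IH] /=; rewrite to_metab_brk ?IH ?to_metabA to_metabB.
    by apply: metabP => //=; mring.
  by apply: metabP => //=; rewrite [X1 ^+ b.+2]exprS; mring.
rewrite to_metab_brk IH to_metabA.
by apply: metabP => //=; rewrite [X0 ^+ a.+2]exprS; mring.
Qed.

Lemma to_metab_p (y : pp k) : (to_metab (val y)).1 = (0, 0).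
Proof.
case: y => y /= /spanP; elim=> {y} [_ [u [v ->]]||a x y _ hx _ hy].
- by rewrite to_metab_brk.
- by rewrite raddf0.
- by rewrite linearP /= hx hy /= scaler0 addr0.
Qed.

Definition p_poly (y : pp k) : {mpoly k[2]} := (to_metab (val y)).2.

Fact p_poly_linear : linear p_poly.
Proof. by move=> a x y; rewrite /p_poly linearP. Qed.
HB.instance Definition _ := GRing.isLinear.Build k (pp k) {mpoly k[2]} _ p_poly
  p_poly_linear.

Lemma p_poly_brk (y : pp k) : y \in span (@is_brk k (pp k)) -> p_poly y = 0.
Proof.
move=> /spanP; elim=> {y} [_ [u [v ->]]||a x y _ hx _ hy].
- rewrite /p_poly /= to_metab_brk /=.
  by rewrite !to_metab_p /=; mring.
- by rewrite raddf0.
- by rewrite linearP /= hx hy /= scaler0 addr0.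
Qed.

Definition pab_poly (z : pab k) : {mpoly k[2]} := p_poly (repr z).

Lemma pab_polyE y : pab_poly (pcls y) = p_poly y.
Proof.
apply/eqP; rewrite -subr_eq0 /pab_poly -raddfB; apply/eqP/p_poly_brk.
by rewrite Quotient.idealrBE reprK.
Qed.

Lemma pcls_surj (z : pab k) : exists y, z = pcls y.
Proof. exact: lcls_surj. Qed.

Fact pab_poly_linear : linear pab_poly.
Proof.
move=> a x y; have [u ->] := pcls_surj x; have [v ->] := pcls_surj y.
by rewrite -linearP /= !pab_polyE linearP.
Qed.
HB.instance Definition _ := GRing.isLinear.Build k (pab k) {mpoly k[2]} _
  pab_poly pab_poly_linear.

Let gA : f2 k := genA k.
Let gB : f2 k := genB k.
Let adp (x : f2 k) (y : pp k) : pp k := Derived (brk_derived x (val y)).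
Let pw a b : pp k := Derived (adAB_p k a b).
(* The span of the elements [pw a b] and of [p, p] *)
Let Q : pp k -> Prop := in_span (fun w => (exists a b, w = pw a b) \/ is_brk w).

Let QD x y : Q x -> Q y -> Q (x + y).
Proof. by move=> hx hy; rewrite -(scale1r x); exact: span_lin. Qed.
Let QZ a x : Q x -> Q (a *: x).
Proof. by move=> hx; rewrite -(addr0 (a *: x)); apply/span_lin/span_0. Qed.
Let Qpw a b : Q (pw a b).
Proof. by apply: span_in; left; exists a, b. Qed.
Let Qbrk (x y : pp k) : Q [lie x, y].
Proof. by apply: span_in; right; exists x, y. Qed.

Let adp_brk x (u v : pp k) :
  adp x [lie u, v] = [lie adp x u, v] + [lie u, adp x v].
Proof. by apply: val_inj; exact: brk_leibniz. Qed.

Let adpP x a (u v : pp k) : adp x (a *: u + v) = a *: adp x u + adp x v.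
Proof. by apply: val_inj; rewrite /= brkDr brkZr. Qed.

Let QadB_pw a b : exists d, is_true (d \in span (@is_brk k (pp k))) /\
  adp gB (pw a b) = pw a b.+1 + d.
Proof.
elim: a => [|a [d [hd IH]]].
  by exists 0; split; [exact: rpred0 | apply: val_inj; rewrite /= addr0].
exists (adp gA d + [lie Derived (brk_derived gB gA), pw a b]).
split.
  apply: rpredD; last exact: brk_derived.
  move/spanP: hd; elim=> {IH} {d} [_ [u [v ->]]||c x y _ hx _ hy].
  - by rewrite adp_brk; apply: rpredD; exact: brk_derived.
  - suff -> : adp gA 0 = 0 by exact: rpred0.
    by apply: val_inj; rewrite /= brk0r.
  - by rewrite adpP; apply: rpredD => //; exact: rpredZ.
apply: val_inj => /=; have /= IH' := congr1 val IH.
by rewrite [LHS]brk_leibniz [X in _ + [lie _, X]]IH' brkDr addrC addrA.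
Qed.

Let Qad_gen x y : x = gA \/ x = gB -> Q y -> Q (adp x y).
Proof.
move=> hx; elim=> {y} [_ [[a [b ->]]|[u [v ->]]]||c u v _ hu _ hv].
- case: hx => ->.
    have -> : adp gA (pw a b) = pw a.+1 b by exact: val_inj.
    exact: Qpw.
  have [d [/spanP hd ->]] := QadB_pw a b; apply: QD; first exact: Qpw.
  elim: hd => {d} [d [u [v ->]]||c u v _ hu _ hv].
  + exact: Qbrk.
  + exact: span_0.
  + by apply: QD => //; exact: QZ.
- by rewrite adp_brk; apply: QD; exact: Qbrk.
- suff -> : adp x 0 = 0 by exact: span_0.
  by apply: val_inj; rewrite /= brk0r.
- by rewrite adpP; apply: QD => //; exact: QZ.
Qed.

Let f2_decomp (x : f2 k) :
  exists c d y, Q y /\ x = c *: gA + d *: gB + val y.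
Proof.
elim/(@pres_ind k gen2 (fun=> False)): x => [[]||x y hx hy|a x hx|x y hx hy].
- by exists 1, 0, 0; split; [exact: span_0 | rewrite scale1r scale0r !addr0].
- by exists 0, 1, 0; split; [exact: span_0 | rewrite scale1r scale0r !addr0 add0r].
- by exists 0, 0, 0; split; [exact: span_0 | rewrite !scale0r !addr0].
- have [c [d [u [hu ->]]]] := hx; have [c' [d' [u' [hu' ->]]]] := hy.
  exists (c + c'), (d + d'), (u + u'); split; first exact: QD.
  by rewrite !scalerDl /= addrACA; congr (_ + _); rewrite addrACA.
- have [c [d [u [hu ->]]]] := hx.
  exists (a * c), (a * d), (a *: u); split; first exact: QZ.
  by rewrite !scalerDr !scalerA.
have [c [d [u [hu ->]]]] := hx; have [c' [d' [u' [hu' ->]]]] := hy.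
exists 0, 0, ((c * d' - d * c') *: pw 0 0 + (c *: adp gA u' + d *: adp gB u')
  + (- c' *: adp gA u - d' *: adp gB u) + [lie u, u']).
split.
  apply: QD (Qbrk _ _); apply: QD; last first.
    by rewrite -scaleNr; apply: QD; apply/QZ/Qad_gen; auto.
  apply: QD; first exact: QZ.
  by apply: QD; apply/QZ/Qad_gen; auto.
rewrite !scale0r !add0r /= /adAB /= -/gA -/gB.
rewrite !brkDl !brkDr !brkZl !brkZr !brkxx !scaler0 !addr0 !add0r.
rewrite (brk_anti gB gA) (brk_anti (val u) gA) (brk_anti (val u) gB).
rewrite !scalerN !scaleNr !scalerA scalerBl -!scalerA.
by rewrite (addrACA (c *: _)) !addrA.
Qed.

Let Qp (y : pp k) : Q y.
Proof.
have [c [d [u [hu e]]]] := f2_decomp (val y).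
have := congr1 (fun x => (to_metab x).1) e.
rewrite /= to_metab_p !linearD !linearZ /= to_metabA to_metabB to_metab_p /=.
move=> h; have := congr1 snd h; have := congr1 fst h; rewrite /= /GRing.scale /=.
rewrite !mulr0 !mulr1 !addr0 add0r => hc hd; move: e.
by rewrite -hc -hd !scale0r !add0r => /val_inj ->.
Qed.

Lemma pab_span (z : pab k) : in_span
  (fun w => exists a b, [/\ (0 < a)%N, (0 < b)%N & w = pbasis k a b]) z.
Proof.
have [y ->] := pcls_surj z; elim: (Qp y) => {y} [y [[a [b ->]]|[u [v ->]]]||a u v _ hu _ hv].
- by apply: span_in; exists a.+1, b.+1.
- by rewrite [pcls _]abel_cls_brk; exact: span_0.
- by rewrite raddf0; exact: span_0.
- by rewrite linearP; exact: span_lin.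
Qed.

Lemma pab_poly_pbasis a b : (0 < a)%N -> (0 < b)%N ->
  pab_poly (pbasis k a b) = X0 ^+ a * X1 ^+ b.
Proof.
by case: a b => // a [//|b] _ _; rewrite pab_polyE /p_poly /= to_metab_adAB.
Qed.

Let mon (a b : nat) : 'X_{1.. 2} := (U_(ord0) *+ a + U_(ord_max) *+ b)%MM.

Let XE a b : X0 ^+ a * X1 ^+ b = 'X_[mon a b].
Proof. by rewrite mpolyXD !mpolyXn. Qed.

Let mon_inj a b c d : (mon a b == mon c d) = (a == c) && (b == d).
Proof.
apply/eqP/andP => [e|[/eqP-> /eqP->]//].
have := congr1 (fun m : 'X_{1.. 2} => m ord0) e.
have := congr1 (fun m : 'X_{1.. 2} => m ord_max) e.
by rewrite /mon !mnmDE !mulmnE !mnm1E /= !(mul0n, mul1n) ?(addn0, add0n) => -> ->.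
Qed.

Lemma pab_poly_inj : injective pab_poly.
Proof.
move=> x y /eqP; rewrite -subr_eq0 -raddfB => /eqP h; apply/eqP.
rewrite -subr_eq0; apply/eqP; move: (x - y) h => {x y} z.
suff [n0 /(_ n0 (leqnn _)) {2}->] : exists n0 : nat, forall n, (n0 <= n)%N ->
    z = \sum_(a < n) \sum_(b < n) (pab_poly z)@_(mon a.+1 b.+1) *: pbasis k a.+1 b.+1.
  by move=> ->; rewrite big1 // => a _; rewrite big1 // => b _; rewrite mcoeff0 scale0r.
elim: (pab_span z) => {z} [_ [[|a] [[|b] [//= _ _ ->]]]||c u v _ [n hu] _ [m hv]].
- exists (maxn a.+1 b.+1) => n; rewrite geq_max => /andP[an bn].
  rewrite (bigD1 (Ordinal an)) //= (bigD1 (Ordinal bn)) //=.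
  rewrite pab_poly_pbasis // XE mcoeffX eqxx scale1r.
  rewrite big1 ?addr0 => [|j jb].
    rewrite big1 ?addr0 // => i ia; rewrite big1 // => j _.
    rewrite mcoeffX mon_inj eqSS; case: eqP => [e|_]; last by rewrite scale0r.
    by case/eqP: ia; apply: val_inj.
  rewrite mcoeffX mon_inj !eqSS andbC; case: eqP => [e|_]; last by rewrite scale0r.
  by case/eqP: jb; apply: val_inj.
- exists 0 => n _; rewrite big1 // => i _; rewrite big1 // => j _.
  by rewrite raddf0 mcoeff0 scale0r.
exists (maxn n m) => N; rewrite geq_max => /andP[nN mN].
rewrite {1}(hu N nN) {1}(hv N mN) scaler_sumr -big_split; apply: eq_bigr => i _.
rewrite scaler_sumr -big_split; apply: eq_bigr => j _ /=.
by rewrite linearP /= mcoeffD mcoeffZ scalerDl scalerA.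
Qed.

(* The image of [pab_poly] is the ideal (AB) *)
Lemma pab_poly_im (f : {mpoly k[2]}) :
  (exists z, pab_poly z = f) <-> (exists g, f = X0 * X1 * g).
Proof.
split=> [[z <-]|[g ->]].
  elim: (pab_span z) => {z f} [_ [[|a] [[|b] [//= _ _ ->]]]||c u v _ [g hu] _ [h hv]].
  - exists (X0 ^+ a * X1 ^+ b); rewrite pab_poly_pbasis // !exprS.
    by rewrite mulrACA.
  - by exists 0; rewrite raddf0 mulr0.
  - by exists (c *: g + h); rewrite linearP /= hu hv mulrDr scalerAr.
exists (\sum_(m <- msupp g) g@_m *: pbasis k (m ord0).+1 (m ord_max).+1).
rewrite raddf_sum [in RHS](mpolyE g) mulr_sumr; apply: eq_bigr => m _.
rewrite /= linearZ /= pab_poly_pbasis // -scalerAr; congr (_ *: _).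
rewrite !exprS mulrACA XE; congr (_ * 'X_[_]).
apply/mnmP => i; rewrite /mon !mnmDE !mulmnE !mnm1E; case: (unliftP ord0 i) => [j ->|->].
  have -> : lift ord0 j = ord_max by apply: val_inj; rewrite [j]ord1.
  by rewrite /= mul0n mul1n.
by rewrite /= mul0n mul1n addn0.
Qed.

End Metabelian.

(* The classes [pbasis a b] with [a, b >= 1] form a basis of p/[p, p], in that
   mapping them to the monomials A^a B^b extends to a linear isomorphism onto
   the ideal (AB) *)
Lemma p_iso_exists (k : fieldType) : exists i : {linear pab k -> {mpoly k[2]}},
  [/\ forall a b, (0 < a)%N -> (0 < b)%N ->
        i (pbasis k a b) = 'X_ord0 ^+ a * 'X_ord_max ^+ b,
      injective i &
      forall f, (exists z, i z = f) <-> (exists g, f = 'X_ord0 * 'X_ord_max * g)].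
Proof.
exists (@pab_poly k); split.
- exact: pab_poly_pbasis.
- exact: pab_poly_inj.
- exact: pab_poly_im.
Qed.

(* The isomorphism i : p/[p, p] -> (AB); it is characterized by [p_isoP], as
   the [pbasis a b] span p/[p, p] by [pab_span] *)
Definition p_iso (k : fieldType) : {linear pab k -> {mpoly k[2]}} :=
  sval (cid (p_iso_exists k)).

Lemma p_isoP (k : fieldType) :
  [/\ forall a b, (0 < a)%N -> (0 < b)%N ->
        p_iso k (pbasis k a b) = 'X_ord0 ^+ a * 'X_ord_max ^+ b,
      injective (p_iso k) &
      forall f, (exists z, p_iso k z = f) <->
                (exists g, f = 'X_ord0 * 'X_ord_max * g)].
Proof. exact: svalP (cid (p_iso_exists k)). Qed.

(* Main.v *)
Require Import Defs.
From HB Require Import structures.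
From mathcomp Require Import all_boot all_order all_algebra.
From mathcomp Require Import fingroup perm.
From mathcomp Require Import mpoly ring.

Set Implicit Arguments.
Unset Strict Implicit.
Unset Printing Implicit Defensive.

Import GRing.Theory.
Local Open Scope ring_scope.

(**
Write [f = i([psi])]. Given weights [x_1, x_2, x_3, x_4], the matrices
[T_ij = (x_j e_i - x_i e_j) (d_i - d_j)] represent t_4 on [k^4], where [(d_i)] is
the dual basis. At [x_3 = 0] the vector [e_3] is a common eigenvector, so that
every bracket kills [e_3], and [T_i3 = x_i U_i] with [U_i = e_3 (d_3 - d_i)],
where [[U_i, U_j] = U_j - U_i]; evaluating [psi] on combinations of the [U_i]
therefore only involves [f]. Let [P] and [P'] be the images of [psi^{1,23,4}]
and [psi^{1,2,34}]. As they commute with [U_2] and [U_4] respectively, their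
third rows agree with their second, respectively fourth rows, and the pentagon
computes [P - P'] in terms of [f]. This gives [P_22] and [P_44]; exchanging the
strands 1 and 4, under which [P] changes sign, gives [P_11]. Now [P] has trace
zero and its rows sum to zero, so
[f(a + b, c) - f(b, c) = f(b + c, a) - f(b, a)].

Thus [f] is a symmetric homogeneous 2-cocycle for the addition, and in
characteristic zero it is a multiple of [(a + b)^n - a^n - b^n]. For even [n]
the three-term equation at [(A, B, C) = (1, 1, -2)] makes the multiple vanish.
*)

(** * Lie morphisms, substitution and degree in the free Lie algebra *)

Section Morphisms.
Variable k : fieldType.
Implicit Types (L M : lieType k) (psi : f2 k).

Lemma lie_morphismE L M (g : L -> M) : lie_morphism g ->
  [/\ g 0 = 0, {morph g : x y / x + y}, forall a, {morph g : x / a *: x} &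
      forall x y, g [lie x, y] = [lie g x, g y]].
Proof.
move=> [gl gb].
have g0 : g 0 = 0.
  have := gl 0 0 0; rewrite !scale0r !add0r => e.
  by have := gl 1 0 0; rewrite !scale1r addr0 -[LHS]addr0 => /addrI <-.
split=> // [x y|a x]; first by have := gl 1 x y; rewrite !scale1r.
by have := gl a x 0; rewrite !addr0 g0 addr0.
Qed.

Lemma lsubstA L (u v : L) : lsubst (genA k) u v = u.
Proof. by have [] := lsubst_morph u v. Qed.

Lemma lsubstB L (u v : L) : lsubst (genB k) u v = v.
Proof. by have [] := lsubst_morph u v. Qed.

Lemma lsubst_rules L (u v : L) :
  [/\ lsubst 0 u v = 0,
      forall x y, lsubst (x + y) u v = lsubst x u v + lsubst y u v,
      forall a x, lsubst (a *: x) u v = a *: lsubst x u v &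
      forall x y, lsubst [lie x, y] u v = [lie lsubst x u v, lsubst y u v]].
Proof. by have [/lie_morphismE[]] := lsubst_morph u v. Qed.

Lemma lsubst0 L (u v : L) : lsubst 0 u v = 0.
Proof. by have [] := lsubst_rules u v. Qed.

Lemma lsubstD L (u v : L) x y : lsubst (x + y) u v = lsubst x u v + lsubst y u v.
Proof. by have [] := lsubst_rules u v. Qed.

Lemma lsubstZ L (u v : L) a x : lsubst (a *: x) u v = a *: lsubst x u v.
Proof. by have [] := lsubst_rules u v. Qed.

Lemma lsubst_brk L (u v : L) x y :
  lsubst [lie x, y] u v = [lie lsubst x u v, lsubst y u v].
Proof. by have [] := lsubst_rules u v. Qed.

Lemma f2_ind (P : f2 k -> Prop) :
  P (genA k) -> P (genB k) -> P 0 -> (forall x y, P x -> P y -> P (x + y)) ->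
  (forall a x, P x -> P (a *: x)) ->
  (forall x y, P x -> P y -> P [lie x, y]) -> forall x, P x.
Proof. by move=> PA PB P0 PD PZ Pb; apply: pres_ind => // -[]. Qed.

Lemma lie_morphism_lsubst L M (g : L -> M) psi u v : lie_morphism g ->
  g (lsubst psi u v) = lsubst psi (g u) (g v).
Proof.
move=> /lie_morphismE[g0 gD gZ gb]; elim/f2_ind: psi => [||| x y hx hy|a x hx|x y hx hy].
- by rewrite !lsubstA.
- by rewrite !lsubstB.
- by rewrite !lsubst0.
- by rewrite !lsubstD gD hx hy.
- by rewrite !lsubstZ gZ hx.
- by rewrite !lsubst_brk gb hx hy.
Qed.

Lemma lsubst_ind L (u v : L) (P : L -> Prop) :
  P u -> P v -> P 0 -> (forall x y, P x -> P y -> P (x + y)) ->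
  (forall a x, P x -> P (a *: x)) ->
  (forall x y, P x -> P y -> P [lie x, y]) -> forall psi, P (lsubst psi u v).
Proof.
move=> Pu Pv P0 PD PZ Pb; elim/f2_ind => [||| x y hx hy|a x hx|x y hx hy].
- by rewrite lsubstA.
- by rewrite lsubstB.
- by rewrite lsubst0.
- by rewrite lsubstD; exact: PD.
- by rewrite lsubstZ; exact: PZ.
- by rewrite lsubst_brk; exact: Pb.
Qed.

(** [P] describes the Lie subalgebra generated by [u] and [v], [Q] its commutators. Elements of p
    are combinations of brackets, so [Q] only has to be linear and to hold on one bracket. *)
Lemma lsubst_p_ind L (u v : L) (P Q : L -> Prop) :
  P u -> P v -> P 0 -> (forall x y, P x -> P y -> P (x + y)) ->
  (forall a x, P x -> P (a *: x)) ->
  (forall x y, P x -> P y -> P [lie x, y]) ->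
  Q 0 -> (forall a x y, Q x -> Q y -> Q (a *: x + y)) ->
  (forall x y, P x -> P y -> Q [lie x, y]) ->
  forall y : pp k, Q (lsubst (val y) u v).
Proof.
move=> Pu Pv P0 PD PZ Pb Q0 QL Qb [y /= /spanP].
elim=> {y} [_ [x [y ->]]||a x y _ hx _ hy].
- by rewrite lsubst_brk; apply: Qb; apply: lsubst_ind.
- by rewrite lsubst0.
- by rewrite lsubstD lsubstZ; exact: QL.
Qed.

(** Commuting [u] and [v] generate the abelian algebra of their linear combinations. *)
Lemma lsubst_p_comm L (u v : L) (y : pp k) :
  [lie u, v] = 0 -> lsubst (val y) u v = 0.
Proof.
move=> uv; pose P (x : L) := exists c d, x = c *: u + d *: v.
apply: (@lsubst_p_ind L u v P (fun x => x = 0)) => //.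
- by exists 1, 0; rewrite scale1r scale0r addr0.
- by exists 0, 1; rewrite scale1r scale0r add0r.
- by exists 0, 0; rewrite !scale0r addr0.
- move=> _ _ [c [d ->]] [c' [d' ->]]; exists (c + c'), (d + d').
  by rewrite !scalerDl addrACA.
- move=> a _ [c [d ->]]; exists (a * c), (a * d).
  by rewrite scalerDr !scalerA.
- move=> _ _ [c [d ->]] [c' [d' ->]]; exists 0, 0.
  rewrite !brkDl !brkDr !brkZl !brkZr !brkxx (brk_anti v u) uv.
  by rewrite oppr0 !scaler0 !scale0r !addr0.
- by move=> a x y' -> ->; rewrite scaler0 addr0.
- move=> _ _ [c [d ->]] [c' [d' ->]].
  rewrite !brkDl !brkDr !brkZl !brkZr !brkxx (brk_anti v u) uv.
  by rewrite oppr0 !scaler0 !addr0.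
Qed.

Lemma f2_decomp psi : exists c d (y : pp k),
  psi = c *: genA k + d *: genB k + val y.
Proof.
elim/f2_ind: psi => [|||x y [c [d [u ->]]] [c' [d' [u' ->]]]|a x [c [d [u ->]]]|x y _ _].
- by exists 1, 0, 0; rewrite scale1r scale0r !addr0.
- by exists 0, 1, 0; rewrite scale1r scale0r add0r addr0.
- by exists 0, 0, 0; rewrite !scale0r !addr0.
- exists (c + c'), (d + d'), (u + u'); rewrite !scalerDl /= addrACA.
  by congr (_ + _); rewrite addrACA.
- by exists (a * c), (a * d), (a *: u); rewrite !scalerDr !scalerA.
- by exists 0, 0, (Derived (brk_derived x y)); rewrite !scale0r !add0r.
Qed.

Lemma lsubst_homogeneous L (n : nat) psi (u v : L) (a : k) : homogeneous n psi ->
  lsubst psi (a *: u) (a *: v) = a ^+ n *: lsubst psi u v.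
Proof.
move=> /spanP; elim=> {psi} [x||b x y _ hx _ hy].
- elim=> {n x} [||m n x y _ hx _ hy].
  + by rewrite !lsubstA.
  + by rewrite !lsubstB.
  + by rewrite !lsubst_brk hx hy brkZl brkZr scalerA exprD.
- by rewrite !lsubst0 scaler0.
- by rewrite !lsubstD !lsubstZ hx hy scalerDr !scalerA mulrC.
Qed.

Lemma lie_monomial_lt2 n psi : lie_monomial n psi ->
  (0 < n)%N /\ ((n < 2)%N -> psi = genA k \/ psi = genB k).
Proof.
elim=> {n psi} [||m n x y _ [m0 _] _ [n0 _]].
- by split=> // _; left.
- by split=> // _; right.
by split; [rewrite addn_gt0 m0 | move: m n m0 n0 => [] // m [] // n; rewrite addSn addnS].
Qed.

Lemma homogeneous_lt2 n psi : homogeneous n psi -> (n < 2)%N ->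
  exists c d, psi = c *: genA k + d *: genB k.
Proof.
move=> h n2; move/spanP: h; elim=> {psi} [x /lie_monomial_lt2[_ /(_ n2)] [->|->]||].
- by exists 1, 0; rewrite scale1r scale0r addr0.
- by exists 0, 1; rewrite scale1r scale0r add0r.
- by exists 0, 0; rewrite !scale0r addr0.
- move=> a x y _ [c [d ->]] _ [c' [d' ->]]; exists (a * c + c'), (a * d + d').
  by rewrite scalerDr !scalerA !scalerDl addrACA.
Qed.

Lemma genA_neq0 : genA k != 0.
Proof.
apply/eqP => /(congr1 (@to_metab k)); rewrite to_metabA raddf0.
by move/(congr1 (fun x => x.1.1)) => /= /eqP; rewrite oner_eq0.
Qed.

End Morphisms.

(** * Evaluation of p at pairs for which [u, v] is a common eigenvector *)

Section MetabelianEvaluation.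
Variable k : fieldType.

Definition point2 (a b : k) (i : 'I_2) : k := if i == ord0 then a else b.

(** The span of [u], [v] and [w = [lie u, v]] is a subalgebra whose brackets all lie on the line of
    [w]. Hence p is sent into a line, and [p, p] to zero. *)
Lemma lsubst_pp_derived (L : lieType k) (u v : L) (a b : k) (y : pp k) :
  [lie u, [lie u, v]] = a *: [lie u, v] ->
  [lie v, [lie u, v]] = b *: [lie u, v] ->
  y \in Defs.span (@is_brk k (pp k)) -> lsubst (val y) u v = 0.
Proof.
set w := [lie u, v] => uw vw.
pose P (x : L) := exists c d e, x = c *: u + d *: v + e *: w.
have PB x y' : P x -> P y' -> exists e, [lie x, y'] = e *: w.
  move=> [c [d [e ->]]] [c' [d' [e' ->]]].
  exists (c * d' - d * c' + (c * e' * a + d * e' * b - e * c' * a - e * d' * b)).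
  rewrite !(brkDl, brkDr, brkZl, brkZr, brkxx, uw, vw, brk_anti w u, brk_anti w v,
    brk_anti v u) -/w.
  rewrite !(scaler0, add0r, addr0, scalerA) -!scaleNr -!scalerDl.
  by rewrite !(scalerN, scalerA) -!scaleNr -!scalerDl; congr (_ *: w); ring.
have line (z : pp k) : exists e, lsubst (val z) u v = e *: w.
  apply: (@lsubst_p_ind k L u v P (fun x => exists e, x = e *: w)) => //.
  - by exists 1, 0, 0; rewrite scale1r !scale0r !addr0.
  - by exists 0, 1, 0; rewrite scale1r !scale0r addr0 add0r.
  - by exists 0, 0, 0; rewrite !scale0r !addr0.
  - move=> _ _ [c [d [e ->]]] [c' [d' [e' ->]]].
    exists (c + c'), (d + d'), (e + e'); rewrite !scalerDl addrACA.
    by congr (_ + _); rewrite addrACA.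
  - move=> a' _ [c [d [e ->]]]; exists (a' * c), (a' * d), (a' * e).
    by rewrite !scalerDr !scalerA.
  - move=> x y' /PB h /h[e ->]; exists 0, 0, e.
    by rewrite !scale0r !add0r.
  - by exists 0; rewrite scale0r.
  - move=> c x y' [e ->] [e' ->]; exists (c * e + e').
    by rewrite scalerA scalerDl.
move=> /spanP; elim=> {y} [_ [x [y ->]]||c x y _ hx _ hy].
- have [e ex] := line x; have [f fy] := line y.
  by rewrite /= lsubst_brk ex fy brkZl brkZr brkxx !scaler0.
- by rewrite /= lsubst0.
- by rewrite /= lsubstD lsubstZ hx hy scaler0 addr0.
Qed.

(** [G] is i([y]) divided by AB. On the line of [u, v] the operators ad u and ad v are the scalars
    [a] and [b], so the basis element of bidegree (i+1, j+1) takes the value a^i b^j [u, v]. *)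
Lemma p_iso_eval (y : pp k) : exists G : {mpoly k[2]},
  p_iso k (pcls y) = 'X_ord0 * 'X_ord_max * G /\
  forall (L : lieType k) (u v : L) (a b : k),
    [lie u, [lie u, v]] = a *: [lie u, v] ->
    [lie v, [lie u, v]] = b *: [lie u, v] ->
    lsubst (val y) u v = G.@[point2 a b] *: [lie u, v].
Proof.
have [iso_mon _ _] := p_isoP k.
have same (L : lieType k) (u v : L) (a b : k) (y1 y2 : pp k) :
    pcls y1 = pcls y2 ->
    [lie u, [lie u, v]] = a *: [lie u, v] ->
    [lie v, [lie u, v]] = b *: [lie u, v] ->
    lsubst (val y1) u v = lsubst (val y2) u v.
  move=> e ha hb; have h : y1 - y2 \in Defs.span (@is_brk k (pp k)).
    by rewrite -lcls_eq0 raddfB subr_eq0; apply/eqP.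
  have := lsubst_pp_derived ha hb h; rewrite /= lsubstD -scaleN1r lsubstZ.
  by rewrite scaleN1r => /eqP; rewrite subr_eq0 => /eqP.
(* The induction runs over the class [z] with its lift [y] arbitrary, because the summands of a
   class are lifted separately; [same] compares lifts. *)
move: {2}(pcls y) (erefl (pcls y)) => z; have hz := pab_span z.
elim: hz y => {z} [z [[|i] [[|j] [//= _ _ ->]]]||c z1 z2 _ h1 _ h2] y e.
- exists ('X_ord0 ^+ i * 'X_ord_max ^+ j); split.
    by rewrite e iso_mon // !exprS mulrACA.
  move=> L u v a b ha hb; rewrite (same L u v a b y _ e ha hb) /=.
  rewrite mevalM !rmorphXn /= !mevalXU /point2 /=.
  rewrite /adAB; set w := [lie u, v].
  have: lsubst (iter j (brk (genB k)) [lie genA k, genB k]) u v = b ^+ j *: w.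
    elim: j {e} => [|j IH] /=; rewrite lsubst_brk lsubstB ?lsubstA ?expr0 ?scale1r //.
    by rewrite IH brkZr hb scalerA exprSr.
  move=> hj; elim: i {e} => [|i IH] /=; first by rewrite hj expr0 mul1r.
  by rewrite lsubst_brk lsubstA IH brkZr ha scalerA mulrAC exprSr.
- exists 0; split; first by rewrite e raddf0 mulr0.
  move=> L u v a b ha hb; rewrite raddf0 scale0r.
  rewrite (same L u v a b y 0 _ ha hb); first exact: lsubst0.
  by rewrite e raddf0.
- have [y1 e1] := pcls_surj z1; have [y2 e2] := pcls_surj z2.
  have [G1 [i1 s1]] := h1 _ (esym e1); have [G2 [i2 s2]] := h2 _ (esym e2).
  exists (c *: G1 + G2); split.
    by rewrite e linearP /= e1 e2 i1 i2 mulrDr scalerAr.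
  move=> L u v a b ha hb.
  rewrite (same L u v a b y (c *: y1 + y2) _ ha hb); last first.
    by rewrite e linearP /= e1 e2.
  rewrite /= lsubstD lsubstZ (s1 L u v a b ha hb) (s2 L u v a b ha hb).
  by rewrite mevalD mevalZ scalerDl scalerA.
Qed.

End MetabelianEvaluation.

(** * Square matrices as a Lie algebra *)

Section MatrixLie.
Variables (k : fieldType) (n : nat).
Implicit Types X Y Z : 'M[k]_n.

Definition mx_brk X Y : 'M[k]_n := X *m Y - Y *m X.

Fact mx_brkDl X Y Z : mx_brk (X + Y) Z = mx_brk X Z + mx_brk Y Z.
Proof. by rewrite /mx_brk mulmxDl mulmxDr opprD addrACA. Qed.
Fact mx_brkDr X Y Z : mx_brk X (Y + Z) = mx_brk X Y + mx_brk X Z.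
Proof. by rewrite /mx_brk mulmxDl mulmxDr opprD addrACA. Qed.
Fact mx_brkZl a X Y : mx_brk (a *: X) Y = a *: mx_brk X Y.
Proof. by rewrite /mx_brk -scalemxAl -scalemxAr scalerBr. Qed.
Fact mx_brkZr a X Y : mx_brk X (a *: Y) = a *: mx_brk X Y.
Proof. by rewrite /mx_brk -scalemxAl -scalemxAr scalerBr. Qed.
Fact mx_brkxx X : mx_brk X X = 0.
Proof. exact: subrr. Qed.
Fact mx_jacobi X Y Z :
  mx_brk X (mx_brk Y Z) + mx_brk Y (mx_brk Z X) + mx_brk Z (mx_brk X Y) = 0.
Proof.
rewrite /mx_brk !(mulmxBl, mulmxBr) !mulmxA !opprB.
move: (X *m Y *m Z) (X *m Z *m Y) (Y *m X *m Z) (Y *m Z *m X) (Z *m X *m Y)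
  (Z *m Y *m X) => a b c d e f.
by apply/matrixP => i j; rewrite !mxE; ring.
Qed.

HB.instance Definition _ := Lmodule_isLie.Build k 'M[k]_n
  mx_brkDl mx_brkDr mx_brkZl mx_brkZr mx_brkxx mx_jacobi.

Lemma brk_mxE X Y : [lie X, Y] = X *m Y - Y *m X.
Proof. by []. Qed.

(** Testing on columns turns products of rank one matrices into successive applications, whose
    coordinates [ring] can compare. *)
Lemma mx_ext X Y : (forall (v : 'cV[k]_n) p, (X *m v) p 0 = (Y *m v) p 0) -> X = Y.
Proof.
move=> h; apply/matrixP => p j; have := h (delta_mx j 0) p.
by rewrite -!colE !mxE.
Qed.

Lemma brk_mxvE X Y (v : 'cV[k]_n) : [lie X, Y] *m v = X *m (Y *m v) - Y *m (X *m v).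
Proof. by rewrite brk_mxE mulmxBl !mulmxA. Qed.

Lemma mx_addE m (A B : 'M[k]_(m, n)) i j : (A + B) i j = A i j + B i j.
Proof. by rewrite mxE. Qed.

Lemma mx_scaleE m a (A : 'M[k]_(m, n)) i j : (a *: A) i j = a * A i j.
Proof. by rewrite mxE. Qed.

Lemma mx_oppE m (A : 'M[k]_(m, n)) i j : (- A) i j = - A i j.
Proof. by rewrite mxE. Qed.

End MatrixLie.

(** * The infinitesimal Gassner representation of t_n *)

Section Gassner.
Variables (k : fieldType) (n : nat) (x : 'I_n -> k).

Definition kohno_col (i j : 'I_n) : 'cV[k]_n := \col_p (x j *+ (p == i) - x i *+ (p == j)).
Definition kohno_row (i j : 'I_n) : 'rV[k]_n := \row_q ((q == i)%:R - (q == j)%:R).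
Definition kohno_mx i j : 'M[k]_n := kohno_col i j *m kohno_row i j.

Lemma sum_delta (F : 'I_n -> k) i : \sum_q (q == i)%:R * F q = F i.
Proof.
rewrite (bigD1 i) //= eqxx mul1r big1 ?addr0 // => q /negbTE->.
by rewrite mul0r.
Qed.

Lemma kohno_mx_mulE i j (v : 'cV[k]_n) p :
  (kohno_mx i j *m v) p 0 = (x j * (p == i)%:R - x i * (p == j)%:R) * (v i 0 - v j 0).
Proof.
rewrite /kohno_mx -mulmxA mxE big_ord1 !mxE !mulr_natr; congr (_ * _).
under eq_bigr => q _ do rewrite mxE mulrBl.
by rewrite sumrB !sum_delta.
Qed.

Lemma kohno_mx_sym i j : kohno_mx i j = kohno_mx j i.
Proof. by apply: mx_ext => v p; rewrite !kohno_mx_mulE; ring. Qed.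

Lemma kohno_mx_rel3 i j l : i != j -> i != l -> j != l ->
  [lie kohno_mx i j + kohno_mx i l, kohno_mx j l] = 0.
Proof.
move=> ij il jl; have [ji [li lj]] : j != i /\ l != i /\ l != j.
  by rewrite !(eq_sym l) (eq_sym j) ij il jl.
apply: mx_ext => v p.
rewrite mul0mx brk_mxvE !mulmxDl !mulmxDr !(mx_addE, mx_oppE, kohno_mx_mulE) [RHS]mxE.
(* With the indices distinct, what remains is a polynomial identity in the weights, the coordinates
   of [v] and the indicators of [p]. *)
rewrite !eqxx !(negbTE ij, negbTE il, negbTE jl, negbTE ji, negbTE li, negbTE lj).
by ring.
Qed.

Lemma kohno_mx_rel4 i j l m : uniq [:: i; j; l; m] ->
  [lie kohno_mx i j, kohno_mx l m] = 0.
Proof.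
rewrite /= !inE !negb_or !andbT => /and3P[/and3P[ij il im] /andP[jl jm] lm].
have [[li lj _] [mi mj ml]] :
    [/\ l != i, l != j & True] /\ [/\ m != i, m != j & m != l].
  by rewrite !(eq_sym l) !(eq_sym m) il jl im jm lm.
apply: mx_ext => v p.
rewrite mul0mx brk_mxvE !(mx_addE, mx_oppE, kohno_mx_mulE) [RHS]mxE.
rewrite !(negbTE ij, negbTE il, negbTE im, negbTE jl, negbTE jm, negbTE lm).
rewrite !(negbTE li, negbTE lj, negbTE mi, negbTE mj, negbTE ml).
by ring.
Qed.

End Gassner.

(** * The pentagon in representations of t_4 *)

Section Pentagon.
Variable k : fieldType.

Lemma tn_rep (n : nat) (L : lieType k) (a : 'I_n -> 'I_n -> L) :
  (forall i j, a i j = a j i) ->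
  (forall i j l, i != j -> i != l -> j != l -> [lie a i j + a i l, a j l] = 0) ->
  (forall i j l m, uniq [:: i; j; l; m] -> [lie a i j, a l m] = 0) ->
  exists g : tn k n -> L, lie_morphism g /\ forall i j, i != j -> g (t k i j) = a i j.
Proof.
move=> a_sym a3 a4.
have [|hg gE] := @plift_morph k (tgen n) (@trel k n) L (fun g => a (val g).1 (val g).2).
  move=> _ [i j ij ji|i j l ij il jl|i j l m ij lm u] /=.
  - by rewrite a_sym scaleN1r subrr.
  - exact: a3.
  - exact: a4.
by eexists; split; [exact: hg | move=> i j ij; rewrite (tE k ij) gE].
Qed.

Lemma ins3E (I1 I2 I3 : {set 'I_4}) (psi : f2 k) :
  [disjoint I1 & I2] -> [disjoint I1 & I3] -> [disjoint I2 & I3] ->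
  ins3 I1 I2 I3 psi =
  lsubst psi (\sum_(a in I1) \sum_(b in I2) t k a b)
             (\sum_(a in I2) \sum_(b in I3) t k a b).
Proof.
move=> d12 d13 d23; have [|hins insE] := @ins_morph k 3 4 [tuple I1; I2; I3].
  have d21 : [disjoint I2 & I1] by rewrite disjoint_sym.
  have d31 : [disjoint I3 & I1] by rewrite disjoint_sym.
  have d32 : [disjoint I3 & I2] by rewrite disjoint_sym.
  by case=> [[|[|[|i]]] hi] [[|[|[|j]]] hj] //= _; rewrite /tnth /=.
rewrite /ins3 /f2_t3 (lie_morphism_lsubst _ _ _ hins) !insE //; last first.
- by rewrite -val_eqE /= !inordK.
- by rewrite -val_eqE /= !inordK.
by rewrite !(tnth_nth set0) /= !inordK.
Qed.

Definition pentagon (psi : f2 k) : Prop :=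
  let s1 := strand 3 1 in let s2 := strand 3 2 in
  let s3 := strand 3 3 in let s4 := strand 3 4 in
  ins3 [set s1; s2] [set s3] [set s4] psi
    - ins3 [set s1] [set s2; s3] [set s4] psi
    + ins3 [set s1] [set s2] [set s3; s4] psi
  = ins3 [set s2] [set s3] [set s4] psi
    + ins3 [set s1] [set s2] [set s3] psi.

(** A family satisfying the relations of t_4 defines a morphism, which moves the pentagon into [L];
    all computations then take place in a chosen target. *)
Lemma pentagon_rep (psi : f2 k) (L : lieType k) (a : 'I_4 -> 'I_4 -> L) :
  pentagon psi ->
  (forall i j, a i j = a j i) ->
  (forall i j l, i != j -> i != l -> j != l -> [lie a i j + a i l, a j l] = 0) ->
  (forall i j l m, uniq [:: i; j; l; m] -> [lie a i j, a l m] = 0) ->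
  let s1 := strand 3 1 in let s2 := strand 3 2 in
  let s3 := strand 3 3 in let s4 := strand 3 4 in
  lsubst psi (a s1 s3 + a s2 s3) (a s3 s4)
    - lsubst psi (a s1 s2 + a s1 s3) (a s2 s4 + a s3 s4)
    + lsubst psi (a s1 s2) (a s2 s3 + a s2 s4)
  = lsubst psi (a s2 s3) (a s3 s4) + lsubst psi (a s1 s2) (a s2 s3).
Proof.
move=> pent a_sym a3 a4 s1 s2 s3 s4; move: pent; rewrite /pentagon -/s1 -/s2 -/s3 -/s4.
have s12 : s1 != s2 by rewrite -val_eqE /= !inordK.
have s13 : s1 != s3 by rewrite -val_eqE /= !inordK.
have s14 : s1 != s4 by rewrite -val_eqE /= !inordK.
have s23 : s2 != s3 by rewrite -val_eqE /= !inordK.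
have s24 : s2 != s4 by rewrite -val_eqE /= !inordK.
have s34 : s3 != s4 by rewrite -val_eqE /= !inordK.
have sum2 (i j : 'I_4) (F : 'I_4 -> tn k 4) : i != j ->
    \sum_(b in [set i; j]) F b = F i + F j.
  by move=> ij; rewrite big_setU1 ?inE //= big_set1.
rewrite !ins3E; try by first [rewrite disjoints1 | rewrite disjoint_sym disjoints1];
  rewrite !inE -!val_eqE /= !inordK.
rewrite !(big_set1, sum2) //.
have [g [hg gE]] := tn_rep a_sym a3 a4.
move/(congr1 g); have [_ gD gZ _] := lie_morphismE hg.
have gN (u : tn k 4) : g (- u) = - g u by rewrite -scaleN1r gZ scaleN1r.
by rewrite !gD gN !(lie_morphism_lsubst _ _ _ hg) !gD !gE.
Qed.

End Pentagon.

(** * Linear part, antisymmetry and centralizers *)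

Section Consequences.
Variable k : fieldType.

Lemma pentagon_linear_part (c d : k) (y : pp k) :
  pentagon (c *: genA k + d *: genB k + val y) -> c = 0 /\ d = 0.
Proof.
set psi := _ + _ => pent.
have psiE (u v : f2 k) : [lie u, v] = 0 -> lsubst psi u v = c *: u + d *: v.
  by move=> uv; rewrite !lsubstD !lsubstZ lsubstA lsubstB lsubst_p_comm ?addr0.
have A0 e : e *: genA k = 0 -> e = 0.
  by move/eqP; rewrite scaler_eq0 (negbTE (genA_neq0 k)) orbF => /eqP.
(* Indices are 0-based: [m = 1] keeps only t_12 and isolates [c], [m = 5] keeps only t_34 and
   isolates [d]. All values are multiples of A, hence commute. *)
pose a (m : nat) (i j : 'I_4) := ((i + j)%N == m)%:R *: genA k.
have a_sym m i j : a m i j = a m j i by rewrite /a addnC.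
have a_comm m i j i' j' : [lie a m i j, a m i' j'] = 0.
  by rewrite brkZl brkZr brkxx !scaler0.
have a_comm3 m i j l : [lie a m i j + a m i l, a m j l] = 0.
  by rewrite brkDl !a_comm addr0.
have eq m := @pentagon_rep k psi _ (a m) pent (a_sym m)
  (fun i j l _ _ _ => a_comm3 m i j l) (fun i j l l' _ => a_comm m i j l l').
split; apply: A0; [have := eq 1%N | have := eq 5%N]; rewrite /a /= !inordK // /=;
  rewrite !(scale0r, scale1r, addr0, add0r) !psiE ?(brk0l, brk0r, brkxx) //;
  by rewrite ?(scaler0, addr0, add0r, subr0, addNr, subrr).
Qed.

(* The morphism t_4 -> f2 with t_12, t_34 |-> A, t_23, t_14 |-> B and
   t_13, t_24 |-> -A-B leaves only two terms of the pentagon. *)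
Lemma pentagon_antisym (y : pp k) (L : lieType k) (u v : L) :
  pentagon (val y) -> lsubst (val y) v u = - lsubst (val y) u v.
Proof.
move=> pent; pose A := genA k; pose B := genB k.
(* The 0-based sum [i + j] is 1 or 5 on t_12, t_34, it is 3 on t_23, t_14, and 2 or 4 on t_13,
   t_24. *)
pose a (m : nat) := if m == 3 then B else if odd m then A else - A - B.
have AC : A + (- A - B) = - B by rewrite addrA subrr add0r.
have CA : - A - B + A = - B by rewrite addrC.
have CB : - A - B + B = - A by rewrite subrK.
have BC : B + (- A - B) = - A by rewrite addrC.
have a_sym (i j : 'I_4) : a (i + j)%N = a (j + i)%N by rewrite addnC.
have a3 (i j l : 'I_4) : i != j -> i != l -> j != l ->
    [lie a (i + j)%N + a (i + l)%N, a (j + l)%N] = 0.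
  move=> ij il jl; suff -> : a (i + j)%N + a (i + l)%N = - a (j + l)%N.
    by rewrite brkNl brkxx oppr0.
  move: i j l ij il jl.
  by move=> [[|[|[|[|?]]]] ?] [[|[|[|[|?]]]] ?] [[|[|[|[|?]]]] ?];
    rewrite -!val_eqE // /a /= => _ _ _; rewrite ?opprB ?opprD ?opprK // addrC.
have a4 (i j l m : 'I_4) : uniq [:: i; j; l; m] ->
    [lie a (i + j)%N, a (l + m)%N] = 0.
  move: i j l m => [[|[|[|[|?]]]] ?] [[|[|[|[|?]]]] ?] [[|[|[|[|?]]]] ?]
    [[|[|[|[|?]]]] ?]; by rewrite /= ?inE -?val_eqE //= ?brkxx.
have := @pentagon_rep k (val y) (f2 k) (fun i j => a (i + j)%N) pent a_sym a3 a4.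
rewrite /= !inordK // /a /= -/A -/B CB AC CA BC.
rewrite [lsubst _ (- A) A]lsubst_p_comm ?brkNl ?brkxx ?oppr0 //.
rewrite [lsubst _ (- B) (- B)]lsubst_p_comm ?brkxx //.
rewrite [lsubst _ A (- A)]lsubst_p_comm ?brkNr ?brkxx ?oppr0 // !addr0.
have [hm _ _] := lsubst_morph u v.
move/(congr1 (fun x => lsubst x u v)); rewrite lsubst0 lsubstD.
rewrite !(lie_morphism_lsubst _ _ _ hm) lsubstA lsubstB => /eqP.
by rewrite eq_sym addr_eq0 => /eqP.
Qed.

(** By the Leibniz rule, the centralizer of [w] is a subalgebra. *)
Lemma brk_lsubst0 (L : lieType k) (w u v : L) (psi : f2 k) :
  [lie w, u] = 0 -> [lie w, v] = 0 -> [lie w, lsubst psi u v] = 0.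
Proof.
move=> wu wv; apply: (@lsubst_ind k L u v (fun x => [lie w, x] = 0)) => //.
- exact: brk0r.
- by move=> x y hx hy; rewrite brkDr hx hy addr0.
- by move=> a x hx; rewrite brkZr hx scaler0.
- by move=> x y hx hy; rewrite brk_leibniz hx hy brk0l brk0r addr0.
Qed.

End Consequences.

(** * The representation at a strand of weight zero *)

Section Star.
Variables (k : fieldType) (n : nat) (x : 'I_n -> k) (s : 'I_n).
Hypothesis xs0 : x s = 0.

(** The matrix U_i. It does not involve the weights, so it stays available when [x i = 0], where
    [kohno_mx x i s] vanishes. *)
Definition star_mx (i : 'I_n) : 'M[k]_n := delta_mx s 0 *m kohno_row k s i.

Lemma star_mx_mulE i (v : 'cV[k]_n) p :
  (star_mx i *m v) p 0 = (p == s)%:R * (v s 0 - v i 0).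
Proof.
rewrite /star_mx -mulmxA mxE big_ord1 !mxE andbT; congr (_ * _).
under eq_bigr => q _ do rewrite mxE mulrBl.
by rewrite sumrB !sum_delta.
Qed.

Lemma star_mxE i p q : star_mx i p q = (p == s)%:R * ((q == s)%:R - (q == i)%:R).
Proof. by rewrite /star_mx mxE big_ord1 !mxE andbT. Qed.

Lemma kohno_mx_star i : kohno_mx x i s = x i *: star_mx i.
Proof. 
by apply: mx_ext => v p; rewrite -scalemxAl [RHS]mxE kohno_mx_mulE star_mx_mulE xs0; ring.
Qed.

Local Ltac mxgo := apply: mx_ext => v p;
  rewrite ?mul0mx ?brk_mxvE -?scalemxAl ?mulmxDl ?mulNmx ?mulmxDr ?mulmxN
    ?(mx_addE, mx_oppE, kohno_mx_mulE, star_mx_mulE).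

Lemma brk_star_star i j : i != s -> j != s ->
  [lie star_mx i, star_mx j] = star_mx j - star_mx i.
Proof.
move=> si sj; mxgo.
by rewrite !eqxx (negbTE si) (negbTE sj) !(mul1r, mul0r, subr0).
Qed.

Lemma brk_kohno_star i j : i != s -> j != s -> i != j ->
  [lie kohno_mx x i j, star_mx j] = x i *: (star_mx i - star_mx j).
Proof.
move=> si sj ij; mxgo; rewrite [RHS]mxE ?(mx_addE, mx_oppE, kohno_mx_mulE, star_mx_mulE).
rewrite !eqxx (eq_sym s i) (eq_sym s j) (eq_sym j i) (negbTE si) (negbTE sj) (negbTE ij) /=.
by ring.
Qed.

(** The relation [t_js, t_ij + t_is] = 0 with the factor [x j] removed, so that it also holds for
    [x j = 0]. *)
Lemma brk_star_kohno_sum i j : i != s -> j != s -> i != j ->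
  [lie star_mx j, kohno_mx x i j + kohno_mx x i s] = 0.
Proof.
move=> si sj ij; have ji : j != i by rewrite eq_sym.
by rewrite kohno_mx_star brkDr brkZr brk_star_star // brk_anti brk_kohno_star // addNr.
Qed.

Lemma brk_star_kohno0 i j l : i != s -> j != s -> i != l -> j != l ->
  [lie star_mx l, kohno_mx x i j] = 0.
Proof.
move=> si sj il jl; mxgo; rewrite [RHS]mxE.
rewrite (eq_sym s i) (eq_sym s j) (eq_sym l i) (eq_sym l j).
by rewrite (negbTE si) (negbTE sj) (negbTE il) (negbTE jl) /=; ring.
Qed.

Lemma kohno_mx_ones i j : kohno_mx x i j *m const_mx 1 = 0 :> 'cV_n.
Proof.
by apply/matrixP => p q; rewrite ord1 kohno_mx_mulE !mxE subrr mulr0.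
Qed.

Lemma kohno_mx_delta i j : i != s -> j != s ->
  kohno_mx x i j *m delta_mx s 0 = 0 :> 'cV_n.
Proof.
move=> si sj; apply/matrixP => p q.
by rewrite ord1 kohno_mx_mulE !mxE (negbTE si) (negbTE sj) subrr mulr0.
Qed.

Lemma star_mx_delta i : i != s -> star_mx i *m delta_mx s 0 = delta_mx s 0 :> 'cV_n.
Proof.
move=> si; apply/matrixP => p q.
by rewrite ord1 star_mx_mulE !mxE (negbTE si) !eqxx !andbT subr0 mulr1.
Qed.

Section Values.
Variables (y : pp k) (G : {mpoly k[2]}).
Hypothesis yG : forall (L : lieType k) (u v : L) (a b : k),
  [lie u, [lie u, v]] = a *: [lie u, v] -> [lie v, [lie u, v]] = b *: [lie u, v] ->
  lsubst (val y) u v = G.@[point2 a b] *: [lie u, v].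

(** Every U_i acts as the identity on differences of U's, so the bracket of the two arguments is an
    eigenvector with eigenvalues [a + b] and [c]. *)
Lemma lsubst_star_star p q r a b c : p != s -> q != s -> r != s ->
  lsubst (val y) (a *: star_mx p + b *: star_mx q) (c *: star_mx r) =
  G.@[point2 (a + b) c] *:
    ((a * c) *: (star_mx r - star_mx p) + (b * c) *: (star_mx r - star_mx q)).
Proof.
move=> ps qs rs.
have w : [lie a *: star_mx p + b *: star_mx q, c *: star_mx r] =
    (a * c) *: (star_mx r - star_mx p) + (b * c) *: (star_mx r - star_mx q).
  by rewrite brkDl !brkZl !brkZr !brk_star_star // !scalerA.
have UUU i i' j : i != s -> i' != s -> j != s ->
    [lie star_mx i, star_mx i' - star_mx j] = star_mx i' - star_mx j.
  by move=> hi hi' hj; rewrite brkDr brkNr !brk_star_star // opprB addrA subrK.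
rewrite (yG (a := a + b) (b := c)) ?w //.
- by rewrite brkDl !brkZl !brkDr !brkZr !UUU // scalerDl.
- by rewrite brkZl brkDr !brkZr !UUU.
Qed.

(** The bracket is a multiple of U_p - U_q, on which T_pq acts by -(x_p + x_q). The scalar [e] may
    stay implicit: U_p - U_q is zero outside the columns [p] and [q]. *)
Lemma lsubst_kohno_star p q b : p != s -> q != s -> p != q ->
  exists e, lsubst (val y) (kohno_mx x p q) (b *: star_mx q) =
    e *: (star_mx p - star_mx q).
Proof.
move=> ps qs pq.
have w : [lie kohno_mx x p q, b *: star_mx q] = (b * x p) *: (star_mx p - star_mx q).
  by rewrite brkZr brk_kohno_star // scalerA.
have qp : q != p by rewrite eq_sym.
rewrite (yG (a := - (x p + x q)) (b := b)) w.
- by rewrite scalerA; eexists.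
- rewrite brkZr brkDr brkNr brk_kohno_star // kohno_mx_sym brk_kohno_star //.
  rewrite -(opprB (star_mx p)) scalerN.
  by rewrite -opprD -scalerDl -scaleNr !scalerA; congr (_ *: _); ring.
- by rewrite brkZl brkZr brkDr brkNr !brk_star_star // subrr subr0.
Qed.

End Values.
End Star.

(** * Rows, eigenvectors and traces *)

Section Commuting.
Variables (k : fieldType) (n : nat) (s : 'I_n).

(** Since U_i has image in the line of e_s, which [X] kills, X U_i = 0. Thus U_i X = 0, and its row
    [s] is the difference of the rows [s] and [i] of [X]. *)
Lemma star_mx_comm_row i (X : 'M[k]_n) : [lie star_mx k s i, X] = 0 ->
  X *m delta_mx s 0 = 0 :> 'cV_n -> forall j, X s j = X i j.
Proof.
rewrite brk_mxE => /eqP; rewrite subr_eq0 => /eqP UX Xs j.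
have := star_mx_mulE s i (X *m delta_mx j 0) s.
rewrite mulmxA UX /star_mx mulmxA Xs !mul0mx.
by rewrite eqxx mul1r -!colE !mxE => /esym/eqP; rewrite subr_eq0 => /eqP.
Qed.

(** On a common eigenvector all matrices generated act by scalars, so their brackets kill it. *)
Lemma lsubst_p_eigen (y : pp k) (u v : 'M[k]_n) (w : 'cV[k]_n) :
  (exists c, u *m w = c *: w) -> (exists c, v *m w = c *: w) ->
  lsubst (val y) u v *m w = 0.
Proof.
move=> hu hv; pose P (X : 'M[k]_n) := exists c, X *m w = c *: w.
have brk0 (X Y : 'M[k]_n) : P X -> P Y -> [lie X, Y] *m w = 0.
  move=> [c hc] [d hd]; rewrite brk_mxvE hc hd -!scalemxAr hc hd !scalerA.
  by rewrite mulrC subrr.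
apply: (@lsubst_p_ind k _ u v P (fun X => X *m w = 0)) => //.
- by exists 0; rewrite mul0mx scale0r.
- by move=> X Y [c hc] [d hd]; exists (c + d); rewrite mulmxDl hc hd scalerDl.
- by move=> a X [c hc]; exists (a * c); rewrite -scalemxAl hc scalerA.
- by move=> X Y hX hY; exists 0; rewrite scale0r brk0.
- by rewrite mul0mx.
- by move=> a X Y hX hY; rewrite mulmxDl -scalemxAl hX hY scaler0 addr0.
Qed.

Lemma lsubst_p_trace (y : pp k) (u v : 'M[k]_n) : \tr (lsubst (val y) u v) = 0.
Proof.
apply: (@lsubst_p_ind k _ u v (fun=> True) (fun X => \tr X = 0)) => //.
- exact: mxtrace0.
- by move=> a X Y hX hY; rewrite mxtraceD mxtraceZ hX hY mulr0 addr0.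
- by move=> X Y _ _; rewrite brk_mxE raddfB /= mxtrace_mulC subrr.
Qed.

End Commuting.

(** * The cocycle identity from the pentagon *)

Section Cocycle.
Variables (k : fieldType) (y : pp k) (G : {mpoly k[2]}).
Hypothesis yG : forall (L : lieType k) (u v : L) (a b : k),
  [lie u, [lie u, v]] = a *: [lie u, v] -> [lie v, [lie u, v]] = b *: [lie u, v] ->
  lsubst (val y) u v = G.@[point2 a b] *: [lie u, v].
Hypothesis pent : pentagon (val y).

(** For [G] as in [p_iso_eval], this is the value of i([y]) at (a, b). *)
Definition p_value (a b : k) : k := a * b * G.@[point2 a b].

Let s1 := strand 3 1. Let s2 := strand 3 2.
Let s3 := strand 3 3. Let s4 := strand 3 4.

Let psi23 (x : 'I_4 -> k) (p q s r : 'I_4) :=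
  lsubst (val y) (kohno_mx x p q + kohno_mx x p s) (kohno_mx x q r + kohno_mx x s r).

(** The relabelling [g] allows a second use with strands 1 and 4 exchanged. The entry (r, r) comes
    from P - P2: P2 has equal rows [s] and [r], and the other three terms of the pentagon are
    supported on row [s]. *)
Lemma psi23_rows (x : 'I_4 -> k) (g : 'I_4 -> 'I_4) : injective g ->
  let p := g s1 in let q := g s2 in let s := g s3 in let r := g s4 in
  x s = 0 -> let P := psi23 x p q s r in
  [/\ P *m delta_mx s 0 = 0 :> 'cV_4, P *m const_mx 1 = 0 :> 'cV_4,
      P q q = P s q &
      P r r = P s r + (p_value (x p + x q) (x r) - p_value (x q) (x r))].
Proof.
move=> ginj p q s r xs P.
have s_neq : [/\ s1 != s2, s1 != s3, s1 != s4 & [/\ s2 != s3, s2 != s4 & s3 != s4]].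
  by rewrite -!val_eqE /= !inordK.
have [pq ps pr [qs qr sr]] : [/\ p != q, p != s, p != r & [/\ q != s, q != r & s != r]].
  by rewrite !(inj_eq ginj).
have rs : r != s by rewrite eq_sym.
have rq : r != q by rewrite eq_sym.
have qp : q != p by rewrite eq_sym.
have TU j : kohno_mx x s j = x j *: star_mx k s j by rewrite kohno_mx_sym kohno_mx_star.
have Udelta := @star_mx_delta k 4 s.
have := @pentagon_rep k (val y) _ (fun i j => kohno_mx x (g i) (g j)) pent
  (fun i j => kohno_mx_sym x (g i) (g j)).
rewrite /= -/s1 -/s2 -/s3 -/s4 -/p -/q -/s -/r -[lsubst _ (kohno_mx x p q + _) _]/P.
set P2 := lsubst _ _ (kohno_mx x q s + _) => pentE.
have {}pentE : P = lsubst (val y) (kohno_mx x p s + kohno_mx x q s) (kohno_mx x s r) + P2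
    - lsubst (val y) (kohno_mx x q s) (kohno_mx x s r)
    - lsubst (val y) (kohno_mx x p q) (kohno_mx x q s).
  rewrite -[RHS]addrA -opprD -pentE => [|i j l ij il jl|i j l m u].
  - by rewrite [X in _ - X]addrAC opprB [RHS]addrC subrK.
  - by apply: kohno_mx_rel3; rewrite (inj_eq ginj).
  - by apply: kohno_mx_rel4; rewrite -[_ :: _]/(map g [:: i; j; l; m]) map_inj_uniq.
have Ps : P *m delta_mx s 0 = 0 :> 'cV_4.
  apply: lsubst_p_eigen.
  - exists (x p); rewrite mulmxDl kohno_mx_delta // add0r kohno_mx_star // -scalemxAl.
    by rewrite Udelta.
  - exists (x r); rewrite mulmxDl kohno_mx_delta // add0r TU // -scalemxAl.
    by rewrite Udelta.
have P2s : P2 *m delta_mx s 0 = 0 :> 'cV_4.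
  apply: lsubst_p_eigen.
  - by exists 0; rewrite kohno_mx_delta // scale0r.
  - exists (x q); rewrite mulmxDl (kohno_mx_delta x qs rs) addr0 kohno_mx_star // -scalemxAl.
    by rewrite Udelta.
(* U_q commutes with psi^{p,qs,r}, as t_23 does with psi^{1,23,4}; likewise U_r and P2 below. *)
have Pq : forall j, P s j = P q j.
  apply: star_mx_comm_row Ps; apply: brk_lsubst0; first exact: brk_star_kohno_sum.
  by rewrite [kohno_mx x q r]kohno_mx_sym [kohno_mx x s r]kohno_mx_sym brk_star_kohno_sum.
have P2r : forall j, P2 s j = P2 r j.
  apply: star_mx_comm_row P2s; apply: brk_lsubst0; first exact: brk_star_kohno0.
  by rewrite addrC brk_star_kohno_sum.
split=> //.
- apply: lsubst_p_eigen; exists 0;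
  by rewrite mulmxDl !kohno_mx_ones addr0 scale0r.
have [e eE] := lsubst_kohno_star x yG (x q) ps qs pq.
have := lsubst_star_star yG (x p) (x q) (x r) ps qs rs.
(* The zero coefficient specializes the formula to the term psi^{2,3,4}. *)
have := lsubst_star_star yG 0 (x q) (x r) ps qs rs.
rewrite !(scale0r, mul0r, add0r) => e1 e2.
move: pentE; rewrite !(kohno_mx_star xs) TU eE e1 e2.
move=> /matrixP pentE; have := pentE s r; have := pentE r r.
rewrite !(mx_addE, mx_oppE, mx_scaleE, star_mxE) /p_value !eqxx P2r.
rewrite (negbTE rs) (negbTE rq) (eq_sym r p) (negbTE pr) /= => -> ->.
by ring.
Qed.

(** Let X and X' be the two sides. The diagonal of P is P_31 - X', P_32, 0, P_34 + X, so its trace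
    is the sum of row 3 plus X - X'. Both the trace and the row sum vanish. *)
Lemma p_value_cocycle a b c :
  p_value (a + b) c - p_value b c = p_value (c + b) a - p_value b a.
Proof.
pose x (i : 'I_4) := if i == s1 then a else if i == s2 then b
  else if i == s4 then c else 0.
have xs : x s3 = 0 by rewrite /x -!val_eqE /= !inordK.
have [x1 x2 x4] : [/\ x s1 = a, x s2 = b & x s4 = c] by rewrite /x -!val_eqE /= !inordK.
have [] := @psi23_rows x id (fun _ _ => id) xs; rewrite x1 x2 x4.
have [] := @psi23_rows x (tperm s1 s4) perm_inj; rewrite ?tpermL ?tpermR.
all: rewrite ?tpermD ?xs //; try by rewrite -!val_eqE /= !inordK.
rewrite x1 x2 x4.
(* Exchanging strands 1 and 4 swaps the two arguments of [y], which changes the sign. *)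
set P := psi23 x s1 s2 s3 s4; have -> : psi23 x s4 s2 s3 s1 = - P.
  rewrite /psi23 [kohno_mx x s4 s2]kohno_mx_sym [kohno_mx x s4 s3]kohno_mx_sym
    [kohno_mx x s2 s1]kohno_mx_sym [kohno_mx x s3 s1]kohno_mx_sym.
  exact: pentagon_antisym.
rewrite !mxE => _ _ _ e1 Ps P1 e2 e4.
have sum4 (F : 'I_4 -> k) : \sum_i F i = F s1 + F s2 + F s3 + F s4.
  rewrite !big_ord_recl big_ord0 addr0 !addrA; congr (F _ + F _ + F _ + F _);
    by apply: val_inj; rewrite /= inordK.
have := lsubst_p_trace y (kohno_mx x s1 s2 + kohno_mx x s1 s3)
  (kohno_mx x s2 s4 + kohno_mx x s3 s4).
rewrite -/(psi23 _ _ _ _ _) -/P /mxtrace sum4 e2 e4.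
have -> : P s3 s3 = 0.
  by move/matrixP: Ps => /(_ s3 0); rewrite -colE !mxE.
have : P s3 s1 + P s3 s2 + P s3 s3 + P s3 s4 = 0.
  move/matrixP: P1 => /(_ s3 0); rewrite !mxE => <-.
  by rewrite -sum4; apply: eq_bigr => i _; rewrite mxE mulr1.
have -> : P s3 s3 = 0.
  by move/matrixP: Ps => /(_ s3 0); rewrite -colE !mxE.
move: e1; set X' := p_value (c + b) a - _; set X := p_value (a + b) c - _.
move: (P s1 s1) (P s3 s1) (P s3 s2) (P s3 s4) X X' => p11 p31 p32 p34 X X' e1 h1 h2.
have -> : X = - p11 - p32 - p34 + (p11 + p32 + 0 + (p34 + X)) by ring.
rewrite h2 e1; transitivity (X' - (p31 + p32 + 0 + p34)); first by ring.
by rewrite h1 subr0.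
Qed.

End Cocycle.

(** * Polynomials and homogeneous cocycles in characteristic zero *)

Section CharZero.
Variable k : fieldType.
Hypothesis k_char0 : [pchar k] =i pred0.

Lemma natr_char0_eq0 m : (m%:R == 0 :> k) = (m == 0%N).
Proof. exact: (pcharf0P k).1. Qed.

Lemma natr_char0_inj : injective (fun m : nat => m%:R : k).
Proof.
move=> m l; wlog lm : m l / (l <= m)%N => [hw|].
  by case/orP: (leq_total l m) => h e; [apply: hw | apply/esym/hw].
move/eqP; rewrite -subr_eq0 -natrB // natr_char0_eq0 subn_eq0 => ml.
by apply/eqP; rewrite eqn_leq ml lm.
Qed.

Lemma poly_nat_eq0 (p : {poly k}) : (forall m : nat, p.[m%:R] = 0) -> p = 0.
Proof.
move=> h; apply: (@roots_geq_poly_eq0 _ _ [seq m%:R | m <- iota 0 (size p)]).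
- by apply/allP => _ /mapP[m _ ->]; apply/rootP.
- by rewrite map_inj_uniq ?iota_uniq //; exact: natr_char0_inj.
- by rewrite size_map size_iota.
Qed.

Lemma mpoly_nat_eq0 (P : {mpoly k[2]}) :
  (forall a b : nat, P.@[point2 a%:R b%:R] = 0) -> P = 0.
Proof.
move=> h; pose Q b : {poly k} :=
  \sum_(m <- msupp P) (P@_m * b ^+ m ord_max) *: 'X^(m ord0).
have evE a b : P.@[point2 a b] = (Q b).[a].
  rewrite mevalE horner_sum; apply: eq_bigr => m _.
  rewrite !big_ord_recl big_ord0 mulr1 hornerZ hornerXn mulrA mulrAC.
  by have -> : lift ord0 ord0 = ord_max :> 'I_2 by exact: val_inj.
(* [Q b] is [P] with its second variable set to [b]; [q i] is the coefficient of the i-th power of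
   the first variable, a polynomial in the second. *)
pose q i : {poly k} := \sum_(m <- msupp P | m ord0 == i) P@_m *: 'X^(m ord_max).
have q0 i : q i = 0.
  apply: poly_nat_eq0 => b; rewrite horner_sum.
  have /(congr1 (fun p : {poly k} => p`_i)) : Q b%:R = 0.
    by apply: poly_nat_eq0 => a; rewrite -evE.
  rewrite coef0 coef_sum => e; rewrite -[RHS]e {e}.
  rewrite [RHS](bigID (fun m : 'X_{1.. 2} => m ord0 == i)) /=.
  rewrite [X in _ = _ + X]big1 ?addr0 => [|m /negbTE mi].
    apply: eq_bigr => m /eqP <-.
    by rewrite hornerZ hornerXn coefZ coefXn eqxx mulr1.
  by rewrite coefZ coefXn eq_sym mi mulr0.
apply/mpolyP => m0; rewrite mcoeff0.
have [m0P|/memN_msupp_eq0 //] := boolP (m0 \in msupp P).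
move/(congr1 (fun p : {poly k} => p`_(m0 ord_max))): (q0 (m0 ord0)).
rewrite coef0 coef_sum => e.
rewrite -[RHS]e {e} -big_filter (bigD1_seq m0) /=; last first.
- by rewrite filter_uniq ?msupp_uniq.
- by rewrite mem_filter eqxx.
rewrite coefZ coefXn eqxx mulr1 big1_seq ?addr0 // => m.
rewrite mem_filter => /andP[mm0 /andP[/eqP e0 _]].
rewrite coefZ coefXn; case: eqP => [e1|_]; last by rewrite mulr0.
case/eqP: mm0; apply/mnmP => i; case: (unliftP ord0 i) => [j ->|-> //].
by have -> : lift ord0 j = ord_max by apply: val_inj; rewrite [j]ord1.
Qed.

(* Writing f as the coboundary of H, homogeneity of f in both arguments forces
   H(dm) = d^n H(m) + m H(d), whose symmetry in d and m determines H. *)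
Lemma homogeneous_cocycle (f : nat -> nat -> k) (n : nat) : (1 < n)%N ->
  (forall a, f a 0 = 0) -> (forall a, f 0 a = 0) ->
  (forall a b c, f (a + b)%N c + f a b = f a (b + c)%N + f b c) ->
  (forall d a b, f (d * a)%N (d * b)%N = d%:R ^+ n * f a b) ->
  exists C, forall a b, f a b = C * ((a + b)%:R ^+ n - a%:R ^+ n - b%:R ^+ n).
Proof.
move=> n1 f0r f0l fC fH; pose H m := \sum_(j < m) f j 1.
have H0 : H 0 = 0 by rewrite /H big_ord0.
have HS m : H m.+1 = H m + f m 1 by rewrite /H big_ord_recr.
have H1 : H 1 = 0 by rewrite HS H0 f0l addr0.
have fE a b : f a b = H (a + b)%N - H a - H b.
  elim: b => [|b IH]; first by rewrite f0r addn0 H0 subr0 subrr.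
  have := fC a b 1; rewrite addn1 IH addnS !HS => e.
  apply/eqP; rewrite -(inj_eq (addIr (f b 1))) -e; apply/eqP; ring.
have HM d m : H (d * m)%N = d%:R ^+ n * H m + m%:R * H d.
  elim: m => [|m IH]; first by rewrite muln0 H0 mulr0 mul0r addr0.
  have := fH d m 1; rewrite !fE muln1 addn1 -mulnSr IH H1 => e.
  have -> : H (d * m.+1) = (H (d * m.+1) - (d%:R ^+ n * H m + m%:R * H d) - H d)
     + (d%:R ^+ n * H m + m%:R * H d) + H d by ring.
  by rewrite e -natr1; ring.
have c0 : 2%:R ^+ n - 2%:R != 0 :> k.
  rewrite -natrX -natrB ?natr_char0_eq0 ?subn_eq0 -?ltnNge.
    by rewrite -[X in (X < _)%N]expn1 ltn_exp2l.
  by rewrite -[X in (X <= _)%N]expn1 leq_exp2l // ltnW.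
(* Comparing [HM 2 m] with [HM m 2] gives (2^n - 2) H(m) = (m^n - m) H(2). *)
pose C := H 2 / (2%:R ^+ n - 2%:R); exists C.
have HE m : H m = C * (m%:R ^+ n - m%:R).
  have := HM m 2; rewrite mulnC HM => e; apply: (mulIf c0).
  rewrite /C mulrAC divfK //; apply/eqP; rewrite -subr_eq0.
  move/eqP: e; rewrite -subr_eq0 => /eqP e.
  by rewrite -[RHS in _ == RHS]e; apply/eqP; ring.
(* The additive term -m of H drops out of the coboundary. *)
by move=> a b; rewrite fE !HE natrD; ring.
Qed.

End CharZero.

(** * Homogeneity and the three-term equation for the values *)

Section PairingProperties.
Variables (k : fieldType) (y : pp k) (G : {mpoly k[2]}).
Hypothesis yG : forall (L : lieType k) (u v : L) (a b : k),
  [lie u, [lie u, v]] = a *: [lie u, v] -> [lie v, [lie u, v]] = b *: [lie u, v] ->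
  lsubst (val y) u v = G.@[point2 a b] *: [lie u, v].

(** With w = U2 - U1 nonzero, [U1, U2] = w and both matrices fix w under ad. Evaluating [y] at a U1,
    b U2 thus reads off [p_value G a b]. *)
Let U1 : 'M[k]_3 := star_mx k ord0 (inord 1).
Let U2 : 'M[k]_3 := star_mx k ord0 (inord 2).

Let U12 : [lie U1, U2] = U2 - U1.
Proof. by apply: brk_star_star; rewrite -val_eqE /= inordK. Qed.

Let U_entry : (U2 - U1) ord0 (inord 2) = -1.
Proof.
rewrite mx_addE mx_oppE !star_mxE !eqxx -!val_eqE /= !inordK //=.
by rewrite !mul1r sub0r subrr subr0.
Qed.

Let U1w : [lie U1, U2 - U1] = U2 - U1.
Proof. by rewrite brkDr brkNr brkxx subr0 U12. Qed.

Let U2w : [lie U2, U2 - U1] = U2 - U1.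
Proof. by rewrite brkDr brkNr brkxx sub0r -brk_anti U12. Qed.

Lemma p_value_homogeneous n d a b : homogeneous n (val y) ->
  p_value G (d * a) (d * b) = d ^+ n * p_value G a b.
Proof.
have ev a' b' : lsubst (val y) (a' *: U1) (b' *: U2) =
    (p_value G a' b') *: (U2 - U1).
  have w : [lie a' *: U1, b' *: U2] = (a' * b') *: (U2 - U1).
    by rewrite brkZl brkZr U12 scalerA.
  rewrite (yG (a := a') (b := b')) w; first by rewrite scalerA mulrC.
  - by rewrite brkZl brkZr U1w.
  - by rewrite brkZl brkZr U2w.
move=> /(lsubst_homogeneous (a *: U1) (b *: U2) d).
rewrite !scalerA !ev => /matrixP/(_ ord0 (inord 2)).
by rewrite !mx_scaleE U_entry !mulrN1 mulrN => /oppr_inj.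
Qed.

(** Under A, B, C |-> U1, U2, -U1-U2 the brackets [A, B], [B, C], [C, A] all become w, on which A,
    B, C act by 1, 1, -2. So G(1,1) + G(1,-2) + G(-2,1) = 0, here multiplied by -2. *)
Lemma p_value_cyclic :
  let A := genA k in let B := genB k in let C := - A - B in
  lsubst (val y) A B + lsubst (val y) B C + lsubst (val y) C A = 0 ->
  - 2%:R * p_value G 1 1 + p_value G 1 (- 2%:R) + p_value G (- 2%:R) 1 = 0.
Proof.
move=> A B C cyc; have [hm _ _] := lsubst_morph U1 U2.
have [_ fD fZ _] := lie_morphismE hm.
have := congr1 (fun x => lsubst x U1 U2) cyc.
rewrite /= lsubst0 !lsubstD !(lie_morphism_lsubst _ _ _ hm).
have -> : lsubst C U1 U2 = - U1 - U2.
  by rewrite /C -scaleN1r -[- B]scaleN1r fD !fZ lsubstA lsubstB !scaleN1r.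
rewrite lsubstA lsubstB.
have UC : [lie U2, - U1 - U2] = U2 - U1.
  by rewrite brkDr !brkNr brkxx subr0 -brk_anti U12.
have CU : [lie - U1 - U2, U1] = U2 - U1.
  by rewrite brkDl !brkNl brkxx oppr0 add0r -brk_anti U12.
have Cw : [lie - U1 - U2, U2 - U1] = (- 2%:R) *: (U2 - U1).
  by rewrite brkDl !brkNl U1w U2w -opprD scaleNr scaler_nat mulr2n.
rewrite (yG (a := 1) (b := 1)) ?U12 ?U1w ?U2w ?scale1r //.
rewrite (yG (a := 1) (b := - 2%:R)) ?UC ?U2w ?Cw ?scale1r //.
rewrite (yG (a := - 2%:R) (b := 1)) ?CU ?U1w ?Cw ?scale1r //.
move=> /matrixP/(_ ord0 (inord 2)).
rewrite !mx_addE !mx_scaleE U_entry [RHS]mxE /p_value => h.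
rewrite -[RHS](mulr0 2%:R) -h; ring.
Qed.

End PairingProperties.

(** * Identification of the class of psi *)

Theorem mainTheorem2 (k : fieldType) (k_char0 : [pchar k] =i pred0)
  (n : nat) (psi : f2 k) (psi_n : homogeneous n psi)
  (psi_cycle : let A := genA k in let B := genB k in let C := - A - B in
    lsubst psi A B + lsubst psi B C + lsubst psi C A = 0)
  (psi_pentagon :
    let s1 := strand 3 1 in let s2 := strand 3 2 in
    let s3 := strand 3 3 in let s4 := strand 3 4 in
    ins3 [set s1; s2] [set s3] [set s4] psi
      - ins3 [set s1] [set s2; s3] [set s4] psi
      + ins3 [set s1] [set s2] [set s3; s4] psi
    = ins3 [set s2] [set s3] [set s4] psi
      + ins3 [set s1] [set s2] [set s3] psi) :
  exists psi_p : pp k, val psi_p = psi /\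
    (odd n /\ (3 <= n)%N ->
       exists c : k, p_iso k (pcls psi_p) =
         c *: (('X_ord0 + 'X_ord_max) ^+ n - 'X_ord0 ^+ n - 'X_ord_max ^+ n)) /\
    (~ (odd n /\ (3 <= n)%N) -> pcls psi_p = 0).
Proof.
have pent : pentagon psi by [].
have [c [d [y ey]]] := f2_decomp psi.
have [c0 d0] := pentagon_linear_part (eq_ind _ _ pent _ ey).
rewrite {}c0 {}d0 !scale0r !add0r in ey.
exists y; split=> //; have [n2|n2] := ltnP n 2.
  have [c' [d' e]] := homogeneous_lt2 psi_n n2.
  have e' : psi = c' *: genA k + d' *: genB k + val (0 : pp k) by rewrite e addr0.
  have [c0 d0] := pentagon_linear_part (eq_ind _ _ pent _ e').
  have -> : y = 0 by apply: val_inj; rewrite -ey e c0 d0 !scale0r addr0.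
  by split=> [[_ n3]|_]; [have := leq_ltn_trans n3 n2 | rewrite raddf0].
rewrite {}ey in psi_n psi_cycle pent; have [G [yE yG]] := p_iso_eval y.
have FE a b : (p_iso k (pcls y)).@[point2 a b] = p_value G a b.
  by rewrite yE !mevalM !mevalXU.
have p0r a : p_value G a 0 = 0 by rewrite /p_value mulr0 mul0r.
have p0l a : p_value G 0 a = 0 by rewrite /p_value !mul0r.
(* The cocycle identity with middle argument 0 is symmetry. *)
have pairC a b : p_value G a b = p_value G b a.
  by have := p_value_cocycle yG pent a 0 b; rewrite !p0l !addr0 !subr0.
have [//||||C CE] := @homogeneous_cocycle k k_char0
  (fun a b => p_value G a%:R b%:R) n n2.
- by move=> a /=; rewrite mulr0n p0l.
- move=> a b c' /=; have := p_value_cocycle yG pent a%:R b%:R c'%:R.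
  rewrite !natrD [b%:R + c'%:R]addrC [p_value G a%:R (_ + _)]pairC.
  rewrite [p_value G a%:R b%:R]pairC => e.
  rewrite -[X in X + _ = _](subrK (p_value G b%:R c'%:R)). rewrite e; ring.
- by move=> e a b /=; rewrite !natrM (p_value_homogeneous yG _ _ _ psi_n).
have isoE : p_iso k (pcls y) =
    C *: (('X_ord0 + 'X_ord_max) ^+ n - 'X_ord0 ^+ n - 'X_ord_max ^+ n).
  apply/eqP; rewrite -subr_eq0; apply/eqP/(mpoly_nat_eq0 k_char0) => a b.
  rewrite mevalB mevalZ !mevalB !rmorphXn /= mevalD !mevalXU FE CE natrD.
  by rewrite subrr.
split=> [_|n_even]; first by exists C.
have [_ iso_inj _] := p_isoP k; apply: iso_inj; rewrite raddf0 isoE.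
have {n_even} en : odd n = false.
  apply/negP => on; apply: n_even; split=> //.
  by case: n on n2 {psi_n CE isoE} => [|[|[]]].
suff -> : C = 0 by rewrite scale0r.
(* For even n, f(1,1) = C (2^n - 2) and f(1,-2) = f(-2,1) = -C 2^n, so the three-term equation
   becomes 4 C (2^n - 1) = 0. *)
have := p_value_cyclic yG psi_cycle.
rewrite -!FE isoE !mevalZ !mevalB !rmorphXn /= !mevalD !mevalXU /point2 /=.
have -> : (1 - 2%:R : k) = -1 by ring.
have -> : (- 2%:R + 1 : k) = -1 by ring.
have sgn : (-1) ^+ n = 1 :> k by rewrite -signr_odd en expr0.
rewrite [(- 2%:R) ^+ n]exprNn sgn mul1r !expr1n => e.
have {e} : C * (4%:R * (2%:R ^+ n - 1)) = 0.
  rewrite -[RHS]oppr0 -[in RHS]e -[(1 + 1 : k)]/(2%:R); ring.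
move/eqP; rewrite mulf_eq0 mulf_eq0 (natr_char0_eq0 k_char0) /= -natrX.
have pos : (0 < 2 ^ n)%N by rewrite expn_gt0.
rewrite -[1 as X in X](mulr1n 1) -natrB // (natr_char0_eq0 k_char0) subn_eq0.
rewrite -[X in (_ <= X)%N](expn0 2) leq_exp2l // leqNgt (ltnW n2) orbF.
by move/eqP.
Qed.
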